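(* Let $N\in\mathbb{N}$, $N\ge 1$, and $\alpha\in(0,N)$. If $V\equiv 1$ on $\mathbb{R}^N$, then $c_*=c_\infty$.
   Context: All functions are real-valued. $I_\alpha:\mathbb{R}^N\setminus\{0\}\to\mathbb{R}$ is the Riesz potential of order $\alpha\in(0,N)$, $$I_\alpha(x)=\frac{\Gamma(\frac{N-\alpha}{2})}{2^{\alpha}\pi^{N/2}\Gamma(\frac{\alpha}{2})\,|x|^{N-\alpha}} .$$ For $u\in L^2(\mathbb{R}^N)$ put $$D(u)=\int_{\mathbb{R}^N}\bigl(I_\alpha*|u|^{\frac{\alpha}{N}+1}\bigr)|u|^{\frac{\alpha}{N}+1},$$ which is finite by the Hardy-Littlewood-Sobolev inequality. Define $$c_\infty=\inf\Bigl\{\int_{\mathbb{R}^N}|u|^2 : u\in L^2(\mathbb{R}^N),\ D(u)=1\Bigr\}>0,$$ and, for $V\in L^\infty(\mathbb{R}^N)$, $$c_*=\inf\Bigl\{\int_{\mathbb{R}^N}|\nabla u|^2+V|u|^2 : u\in H^1(\mathbb{R}^N),\ D(u)=1\Bigr\}.$$ *)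

(* Defs.v *)
From HB Require Import structures.
From mathcomp Require Import all_boot all_order all_algebra.
From mathcomp Require Import all_classical all_reals all_analysis.

Set Implicit Arguments.
Unset Strict Implicit.
Unset Printing Implicit Defensive.
Import Order.TTheory GRing.Theory Num.Theory.
Import numFieldNormedType.Exports.
Local Open Scope classical_set_scope.
Local Open Scope ring_scope.

(* The product sigma-algebra on row vectors, generated by the coordinates; for
   real entries this is the Borel sigma-algebra of R^n. *)
Section measurable_row.
Context d (T : measurableType d) (n : nat).

Let coord (i : 'I_n) (x : 'rV[T]_n) : T := x ord0 i.

Let row_set0 : g_sigma_preimage coord set0.
Proof. exact: sigma_algebra0. Qed.

Let row_setC A : g_sigma_preimage coord A -> g_sigma_preimage coord (~` A).
Proof. exact: sigma_algebraC. Qed.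

Let row_bigcup (F : (set 'rV[T]_n)^nat) :
  (forall k, g_sigma_preimage coord (F k)) ->
  g_sigma_preimage coord (\bigcup_k F k).
Proof. exact: sigma_algebra_bigcup. Qed.

HB.instance Definition _ := @isMeasurable.Build (measure_tuple_display d)
  'rV[T]_n (g_sigma_preimage coord) row_set0 row_setC row_bigcup.

Lemma measurable_coord (i : 'I_n) :
  measurable_fun [set: 'rV[T]_n] (fun x : 'rV[T]_n => x ord0 i).
Proof.
move=> _ Y mY; rewrite setTI; apply: sub_sigma_algebra => /=.
rewrite -bigcup_seq/=; exists i => /=; first by rewrite mem_index_enum.
by exists Y => //; rewrite setTI.
Qed.

Lemma measurable_fun_row d' (T' : measurableType d') (f : T' -> 'rV[T]_n) :
  (forall i, measurable_fun [set: T'] (fun x => f x ord0 i)) ->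
  measurable_fun [set: T'] f.
Proof.
move=> mf _ A mA; rewrite setTI.
suff : g_sigma_preimage coord `<=` [set B | measurable (f @^-1` B)] by exact.
apply: smallest_sub => [|B].
  split=> [|B /= mB|F /= mF].
  - by rewrite /= preimage_set0.
  - by rewrite setTD preimage_setC; exact: measurableC.
  - by rewrite preimage_bigcup; exact: bigcupT_measurable.
rewrite -bigcup_seq/= => -[i _ [C mC <-]] /=.
by rewrite setTI; have := mf i measurableT C mC; rewrite setTI.
Qed.

End measurable_row.

Definition row_cons {T : Type} n (p : T * 'rV[T]_n) : 'rV[T]_n.+1 :=
  \row_i oapp (fun j => p.2 ord0 j) p.1 (unlift ord0 i).

Definition row_uncons {T : Type} n (x : 'rV[T]_n.+1) : T * 'rV[T]_n :=
  (x ord0 ord0, \row_j x ord0 (lift ord0 j)).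

Lemma row_consK {T : Type} n : cancel (@row_cons T n) (@row_uncons T n).
Proof.
move=> [t x]; rewrite /row_uncons mxE unlift_none /=; congr pair.
by apply/rowP => j; rewrite !mxE liftK.
Qed.

Section lebesgue_measure_row_succ.
Context {R : realType} (n : nat).
Variable mu : {sigma_finite_measure set 'rV[R]_n -> \bar R}.

Let T := (measurableTypeR R * 'rV[R]_n)%type.

Lemma measurable_row_cons : measurable_fun [set: T] (@row_cons R n).
Proof.
apply: measurable_fun_row => i; under eq_fun do rewrite mxE.
case: unliftP => [j _|_] /=; last exact: measurable_fst.
exact: (measurableT_comp (measurable_coord j) measurable_snd).
Qed.

Lemma measurable_row_uncons :
  measurable_fun [set: 'rV[R]_n.+1] (@row_uncons R n : _ -> T).
Proof.
apply: measurable_fun_pair; first exact: measurable_coord.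
by apply: measurable_fun_row => i; under eq_fun do rewrite mxE;
  exact: measurable_coord.
Qed.

Definition lebesgue_row_succ : set 'rV[R]_n.+1 -> \bar R :=
  pushforward (@lebesgue_measure R \x mu)%E (@row_cons R n : T -> _).

Let m := measure_function_pushforward__canonical__measure_function_Measure
  (@lebesgue_measure R \x mu)%E measurable_row_cons.

HB.instance Definition _ := isMeasure.Build _ _ _ lebesgue_row_succ
  (@measure0 _ _ _ m) (@measure_ge0 _ _ _ m)
  (@measure_semi_sigma_additive _ _ _ m).

Let lebesgue_row_succ_sigma_finite : sigma_finite setT lebesgue_row_succ.
Proof.
have /sigma_finiteP[F [TF ndF Foo]] := sigma_finiteT (@lebesgue_measure R).
have /sigma_finiteP[G [TG ndG Goo]] := sigma_finiteT mu.
exists (fun k => @row_uncons R n @^-1` (F k `*` G k)).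
  apply/esym; rewrite -subTset => x _.
  have [j _ Fj] : (\bigcup_k F k) (row_uncons x).1 by rewrite -TF.
  have [k _ Gk] : (\bigcup_k G k) (row_uncons x).2 by rewrite -TG.
  exists (maxn j k) => //; split => /=.
    by move: Fj; exact/subsetPset/ndF/leq_maxl.
  by move: Gk; exact/subsetPset/ndG/leq_maxr.
move=> k; have [mF Fk] := Foo k; have [mG Gk] := Goo k; split.
  rewrite -[X in measurable X]setTI; apply: measurable_row_uncons => //.
  exact: measurableX.
rewrite /lebesgue_row_succ /pushforward -comp_preimage.
rewrite (_ : _ \o _ = id) ?preimage_id; last exact/funext/row_consK.
by rewrite product_measure1E// lte_mul_pinfty// ge0_fin_numE.
Qed.

HB.instance Definition _ := Measure_isSigmaFinite.Build _ _ _
  lebesgue_row_succ lebesgue_row_succ_sigma_finite.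

End lebesgue_measure_row_succ.

Fixpoint lebesgue_row (R : realType) (n : nat) :
    {sigma_finite_measure set 'rV[R]_n -> \bar R} :=
  if n is n'.+1 then lebesgue_row_succ (lebesgue_row R n') else \d_(0 : 'rV[R]_0).

Lemma lebesgue_row_box (R : realType) (n : nat) (A : 'I_n -> set R) :
  (forall i, measurable (A i)) ->
  lebesgue_row R n [set x | forall i, A i (x ord0 i)] =
  (\prod_(i < n) lebesgue_measure (A i))%E.
Proof.
elim: n A => [|n IHn] A mA.
  by rewrite big_ord0 /= diracE mem_set// => -[].
rewrite big_ord_recl -(IHn (fun j => A (lift ord0 j)))//.
have mB : measurable
    [set x : 'rV[R]_n | forall j, A (lift ord0 j) (x ord0 j)].
  have -> : [set x : 'rV[R]_n | forall j, A (lift ord0 j) (x ord0 j)] =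
      \bigcap_(j in [set: 'I_n])
        ((fun x : 'rV[R]_n => x ord0 j) @^-1` A (lift ord0 j)).
    by apply/seteqP; split => [x Ax i _|x Ax i]; exact: Ax.
  apply: fin_bigcap_measurable => // i _.
  by rewrite -[X in measurable X]setTI; exact: measurable_coord.
rewrite -product_measure1E//; last exact: mA.
rewrite [LHS]/= /lebesgue_row_succ /pushforward; congr (_ _).
apply/seteqP; split => [[t x] /= Ap|[t x] [/= At Ax] i].
  split => [|j] /=; first by have := Ap ord0; rewrite mxE unlift_none.
  by have := Ap (lift ord0 j); rewrite mxE liftK.
by rewrite mxE; case: unliftP => [j ->|->].
Qed.

Section riesz.
Context {R : realType}.

Definition gamma_fun (s : R) : R :=
  \int[lebesgue_measure]_(t in `]0, +oo[) (t `^ (s - 1) * expR (- t)).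

Context {N : nat}.
Local Notation mu := (lebesgue_row R N).
Implicit Types (alpha : R) (u : 'rV[R]_N -> R).

(* The library's norm `|x| on row vectors is the sup norm. *)
Definition enorm (x : 'rV[R]_N) : R := Num.sqrt (\sum_i x ord0 i ^+ 2).

(* The value at the origin is irrelevant: it is 0 when alpha != N, since
   0 `^ a = 0 for a != 0 and 0^-1 = 0. *)
Definition riesz_potential alpha (x : 'rV[R]_N) : R :=
  gamma_fun ((N%:R - alpha) / 2) /
  (2 `^ alpha * pi `^ (N%:R / 2) * gamma_fun (alpha / 2) *
   enorm x `^ (N%:R - alpha)).

Definition convolution (f g : 'rV[R]_N -> R) (x : 'rV[R]_N) : \bar R :=
  (\int[mu]_y (f (x - y) * g y)%:E)%E.

Definition riesz_energy alpha u : \bar R :=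
  let w x := `|u x| `^ (alpha / N%:R + 1) in
  (\int[mu]_x (convolution (riesz_potential alpha) w x * (w x)%:E))%E.

Fixpoint class_C (k : nat) (f : 'rV[R]_N -> R) : Prop :=
  continuous f /\
  if k is k'.+1 then
    forall i : 'I_N, (forall x, derivable f x (delta_mx ord0 i)) /\
                     class_C k' ('D_(delta_mx ord0 i) f)
  else True.

Definition test_function (phi : 'rV[R]_N -> R) : Prop :=
  (forall k, class_C k phi) /\ compact (closure [set x | phi x != 0]).

(* [G] represents the weak gradient of [u], and is determined by [u] up to a
   null set. Only meant for [u] and the components of [G] locally integrable
   (below they are in L^2), so that both integrals converge. *)
Definition weak_gradient u (G : 'rV[R]_N -> 'rV[R]_N) : Prop :=
  forall phi, test_function phi -> forall i : 'I_N,
    \int[mu]_x (u x * 'D_(delta_mx ord0 i) phi x) =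
    - \int[mu]_x (G x ord0 i * phi x).

Definition H1_gradient u (G : 'rV[R]_N -> 'rV[R]_N) : Prop :=
  weak_gradient u G /\ forall i : 'I_N, (fun x => G x ord0 i) \in Lfun mu 2%:E.

Definition H1 u : Prop := u \in Lfun mu 2%:E /\ exists G, H1_gradient u G.

Definition c_infty alpha : \bar R :=
  ereal_inf [set (\int[mu]_x (`|u x| ^+ 2)%:E)%E | u in
    [set u | u \in Lfun mu 2%:E /\ riesz_energy alpha u = 1%E]].

(* The infimum runs over the admissible [u] together with a representative [G]
   of the gradient, on which the integral does not depend. *)
Definition c_star alpha (V : 'rV[R]_N -> R) : \bar R :=
  ereal_inf [set E | exists u G,
    [/\ H1 u, H1_gradient u G, riesz_energy alpha u = 1%E &
        E = (\int[mu]_x (enorm (G x) ^+ 2 + V x * `|u x| ^+ 2)%:E)%E]].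

End riesz.
Arguments c_infty {R} N alpha.

(* Main.v *)
(* Dropping the gradient term gives [c_infty <= c_star]. Conversely, the L^2
   norm and the Riesz energy of an L^2 function are invariant under
   [u |-> l^(N/2) u(l .)], while the Dirichlet integral is multiplied by [l^2];
   so a competitor for [c_infty] that is C^1 with bounded support becomes, as
   [l] goes to 0, an almost equally good one for [c_star]. A general competitor
   [u] is approximated in L^2, and almost everywhere, by such functions [v]:
   Fatou's lemma gives energies almost as large as that of [u], and a factor
   close to 1 normalises them. The energy of [v] is finite by local
   integrability of the kernel, so the Hardy-Littlewood-Sobolev inequality is
   not needed. *)
Require Import Defs.
From HB Require Import structures.
From mathcomp Require Import all_boot all_order all_algebra.
From mathcomp Require Import all_classical all_reals all_analysis.
From mathcomp Require Import measurable_realfun.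
From mathcomp Require Import ring lra.

Set Implicit Arguments.
Unset Strict Implicit.
Unset Printing Implicit Defensive.
Import Order.TTheory GRing.Theory Num.Theory.
Import numFieldNormedType.Exports.
Local Open Scope classical_set_scope.
Local Open Scope ring_scope.

(** * Open boxes as a generating family of the sigma-algebra on row vectors *)

Section boxes.
Context {R : realType} {N : nat}.
Implicit Types (a b x : 'rV[R]_N).

(** Three choices shape the argument. The approximants are only C^1: squared positive parts are
    already C^1, so bumps are explicit products of them and nothing is mollified, while C^1
    regularity suffices to identify the weak gradient with the classical one. The approximants
    target |u| instead of u; this is harmless because the L^2 norm and the energy depend on |u|
    alone, and it allows increasing simple functions to be used. Their squared L^2 errors are
    summable, so the whole sequence converges almost everywhere.

    Finiteness of the energy of v matters because the normalising factor is a power of that energy,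
    which has to be a real number.

    Translations and dilations are handled by one principle: a measure is determined by its finite
    values on boxes. Translation invariance in turn yields integration by parts, since difference
    quotients of a function with bounded support have integral zero. *)

Definition box a b : set 'rV[R]_N :=
  [set x | forall i, x ord0 i \in `]a ord0 i, b ord0 i[].

Definition cube (r : R) := box (const_mx (- r)) (const_mx r).

Definition boxes := [set box a b | a in setT & b in setT].

Lemma ltr_normrV (x : 'rV[R]_N) (r : R) : 0 < r ->
  `|x| < r <-> forall i, `|x ord0 i| < r.
Proof.
move=> r0; have := @mx_norm_ball R 1 N; move=> /(congr1 (fun f => f 0 r x)).
rewrite /ball_ /= sub0r normrN => <-; split=> [[_ xr] i|xr].
  by have := xr ord0 i; rewrite !mxE /ball /= sub0r normrN.
split=> // i j; rewrite ord1 !mxE /ball /= sub0r normrN; exact: xr.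
Qed.

Lemma ler_coord_norm (x : 'rV[R]_N) i : `|x ord0 i| <= `|x|.
Proof.
by rewrite [leRHS]/Num.norm /= mx_normrE; apply/bigmax_geP; right;
  exists (ord0, i).
Qed.

Lemma cubeP (r : R) x : 0 < r -> cube r x <-> `|x| < r.
Proof.
move=> r0; rewrite ltr_normrV//; split=> + i => /(_ i).
  by rewrite !mxE in_itv/= ltr_norml.
by rewrite !mxE in_itv/= ltr_norml.
Qed.

Lemma setI_closed_boxes : setI_closed boxes.
Proof.
move=> _ _ [a _ [b _ <-]] [c _ [d _ <-]].
exists (\row_i Num.max (a ord0 i) (c ord0 i)) => //.
exists (\row_i Num.min (b ord0 i) (d ord0 i)) => //.
apply/seteqP; split=> [x xabcd|x [xab xcd] i].
  by split=> i; have := xabcd i;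
    rewrite !mxE !in_itv/= gt_max lt_min => /andP[/andP[ax cx] /andP[xb xd]];
    apply/andP.
have := xab i; have := xcd i.
rewrite !mxE !in_itv/= gt_max lt_min => /andP[cx xd] /andP[ax xb].
by rewrite ax cx xb xd.
Qed.

Lemma bigcup_cube : \bigcup_k cube k.+1%:R = setT.
Proof.
rewrite -subTset => x _; exists (Num.truncn `|x|) => //.
by apply/cubeP; rewrite // truncnS_gt.
Qed.

Lemma boxesE_bigcup (i : 'I_N) (s t : R) :
  [set x : 'rV[R]_N | x ord0 i \in `]s, t[] =
  \bigcup_k box (\row_j if j == i then s else - k.+1%:R)
                (\row_j if j == i then t else k.+1%:R).
Proof.
apply/seteqP; split=> [x xst|x [k _] /(_ i)]; last by rewrite !mxE eqxx.
have [k _ xk] : (\bigcup_k cube k.+1%:R) x by rewrite bigcup_cube.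
exists k => // j; rewrite !mxE; case: eqP => [->//|_].
by have := xk j; rewrite !mxE.
Qed.

(** A box is a finite intersection of coordinate preimages; conversely a slab over an open interval
    is a countable union of boxes, and open intervals generate the Borel sets of the line. Boxes
    thus form a generating pi-system, as needed for uniqueness of measures and for Dynkin's
    argument. *)
Lemma measurable_rowE :
  @measurable _ 'rV[R]_N = <<s boxes >>.
Proof.
apply/seteqP; split; last first.
  apply: smallest_sub; first exact: sigma_algebra_measurable.
  move=> _ [a _ [b _ <-]].
  rewrite (_ : box a b = \bigcap_(j in [set: 'I_N])
      ((fun x : 'rV[R]_N => x ord0 j) @^-1` `]a ord0 j, b ord0 j[)).
    apply: fin_bigcap_measurable => // i _; rewrite -[X in measurable X]setTI.
    by apply: measurable_coord => //; exact: measurable_itv.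
  by apply/seteqP; split=> [x Ax i _|x Ax i]; exact: Ax.
apply: smallest_sub; first exact: smallest_sigma_algebra.
move=> A; rewrite -bigcup_seq/= => -[i _ [Y mY <-]]; rewrite setTI.
have : (@RGenOpens.G R).-sigma.-measurable Y by rewrite -RGenOpens.measurableE.
pose S := [set Y : set R | <<s boxes >> ((fun x : 'rV[R]_N =>
  x ord0 i) @^-1` Y)].
suff : <<s @RGenOpens.G R >> `<=` S by exact.
apply: smallest_sub; rewrite /S.
  split=> [|B /= mB|F /= mF].
  - by rewrite /= preimage_set0; exact: sigma_algebra0.
  - by rewrite setTD preimage_setC; exact: sigma_algebraC.
  - by rewrite preimage_bigcup; exact: sigma_algebra_bigcup.
move=> _ [s [t ->]] /=.
rewrite (_ : _ @^-1` _ = [set x : 'rV[R]_N | x ord0 i \in `]s, t[])//.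
rewrite boxesE_bigcup; apply: sigma_algebra_bigcup => k.
by apply: sub_sigma_algebra; do 2 eexists.
Qed.

Lemma measurable_box a b : measurable (box a b).
Proof. by rewrite measurable_rowE; apply: sub_sigma_algebra; do 2 eexists. Qed.

Lemma lebesgue_row_boxE a b : lebesgue_row R N (box a b) =
  (\prod_(i < N) Num.max 0 (b ord0 i - a ord0 i))%:E.
Proof.
rewrite (lebesgue_row_box (A := fun i => `]a ord0 i, b ord0 i[%classic))//.
rewrite -prodEFin; apply: eq_bigr => i _; rewrite lebesgue_measure_itv/=
  lte_fin.
by case: ltP => [ab|ba]; [rewrite max_r// subr_ge0 ltW|rewrite max_l//
  subr_le0].
Qed.

Lemma lebesgue_cube_lty (r : R) : (lebesgue_row R N (cube r) < +oo)%E.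
Proof. by rewrite lebesgue_row_boxE ltry. Qed.

End boxes.

(** * Borel measurability and affine changes of variables *)

Section row_measurability.
Context {R : realType} {N : nat}.
Local Notation mu := (lebesgue_row R N).
Implicit Types (a b x : 'rV[R]_N).

Lemma open_row_measurable (A : set 'rV[R]_N) : open A -> measurable A.
Proof.
move=> oA.
(* Rational centres and radii [k.+1%:R^-1] give a countable family. A side [2 * k.+1%:R^-1] below
   [e] keeps every such box containing [x] inside the ball of radius [e] around [x]. *)
pose B (q : 'rV[rat]_N) k : set 'rV[R]_N :=
  box (\row_j (ratr (q ord0 j) - k.+1%:R^-1)) (\row_j (ratr (q ord0 j) +
    k.+1%:R^-1)).
rewrite (_ : A = \bigcup_q \bigcup_k if `[< B q k `<=` A >] then B q k else
  set0).
  apply: countable_bigcupT_measurable => // q; apply: bigcupT_measurable => k.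
  by case: ifPn => _ //; exact: measurable_box.
apply/seteqP; split=> [x Ax|x [q _ [k _]]];
  last by case: asboolP => [BA /BA|_ []].
have /nbhs_ballP[e /= e0 xeA] : nbhs x A by exact: open_nbhs_nbhs.
have [k ke] : exists k, 2 * k.+1%:R^-1 < e.
  have e2 : 0 < e / 2 by rewrite divr_gt0.
  exists (Num.truncn (e / 2)^-1).
  rewrite mulrC -ltr_pdivlMr// invf_plt ?posrE//.
  exact: truncnS_gt.
have k0 : 0 < k.+1%:R^-1 :> R by rewrite invr_gt0.
have xq i : {q : rat | `|x ord0 i - ratr q| < k.+1%:R^-1}.
  apply/cid; have /rat_in_itvoo[q] : x ord0 i - k.+1%:R^-1 < x ord0 i +
    k.+1%:R^-1.
    by rewrite ltrD2l gtrN.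
  by rewrite inE/= => xqx; exists q; rewrite distrC ltr_distl.
exists (\row_i sval (xq i)) => //; exists k => //.
have Bx : B (\row_i sval (xq i)) k x.
  move=> i; rewrite !mxE in_itv/=; case: (xq i) => q/=.
  by rewrite ltr_distl.
case: asboolP => [//|[]] y By; apply: xeA.
split=> // i j; rewrite ord1 /ball/=.
have := By j; have := Bx j; rewrite !mxE !in_itv/= -!ltr_distl => xj yj.
rewrite -(subrKA (ratr (sval (xq j)))); apply: le_lt_trans (ler_normD _ _) _.
apply: lt_trans ke; rewrite mulr_natl mulr2n ltrD// distrC//.
Qed.

Lemma continuous_row_measurable (f : 'rV[R]_N -> R) :
  continuous f -> measurable_fun setT f.
Proof.
move=> /continuousP cf.
apply: (measurability _ (RGenOpens.measurableE R)).
move=> _ [_ [a [b ->] <-]]; rewrite setTI; apply: open_row_measurable.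
exact/cf/interval_open.
Qed.

Lemma measurable_affine (l : R) b :
  measurable_fun setT (fun x : 'rV[R]_N => l *: x + b).
Proof.
apply: measurable_fun_row => i; under eq_fun do rewrite !mxE.
apply: measurable_funD => //; apply: measurable_funM => //.
exact: measurable_coord.
Qed.

Lemma measurable_subl x : measurable_fun setT (fun y : 'rV[R]_N => x - y).
Proof.
have := measurable_affine (-1) x; apply: eq_measurable_fun => y _.
by rewrite scaleN1r addrC.
Qed.

Lemma measurable_comp_scale (l : R) (w : 'rV[R]_N -> R) :
  measurable_fun setT w -> measurable_fun setT (fun x => w (l *: x)).
Proof.
move=> mw.
apply: eq_measurable_fun (measurableT_comp mw (measurable_affine l 0)) => x _.
by rewrite /= addr0.
Qed.

Let scaled_pushforward (l : R) (l0 : 0 <= l) b :=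
  mscale (NngNum (exprn_ge0 N l0))
    (measure_function_pushforward__canonical__measure_function_Measure
      mu (measurable_affine l b)).

(** Both sides are measures in [A]. They agree on boxes by the product formula, and cubes of finite
    measure exhaust the space, so they coincide. *)
Lemma lebesgue_row_affine (l : R) (l0 : 0 < l) b A : measurable A ->
  mu A = ((l ^+ N)%:E * mu ((fun x => (l *: x + b : 'rV[R]_N)%R) @^-1` A))%E.
Proof.
move=> mA; pose m2 := scaled_pushforward (ltW l0) b.
apply: (measure_unique boxes (fun k => cube k.+1%:R) measurable_rowE
  setI_closed_boxes _ bigcup_cube mu m2) => //.
- by move=> k; do 2 eexists.
- move=> _ [c _ [d _ <-]].
  rewrite -[LHS]/(mu (box c d)) -[RHS]/((l ^+ N)%:E *
    mu ((fun x => (l *: x + b : 'rV[R]_N)%R) @^-1` box c d))%E.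
  rewrite lebesgue_row_boxE.
  rewrite (_ : _ @^-1` _ = box (l^-1 *: (c - b)) (l^-1 *: (d - b))).
    rewrite lebesgue_row_boxE -EFinM; congr EFin.
    rewrite -[X in l ^+ X]card_ord -prodr_const -big_split/=.
    apply: eq_bigr => i _; rewrite !mxE -mulrBr maxr_pMr ?ltW//.
    rewrite mulr0 mulrA divff ?gt_eqF// mul1r; congr Num.max.
    by rewrite opprB addrA subrK.
  apply/seteqP; split=> x xcd i; have := xcd i; rewrite !mxE !in_itv/=;
    by rewrite ltr_pdivrMl// ltr_pdivlMl// ltrBlDr ltrBrDr.
- by move=> k; exact: lebesgue_cube_lty.
Qed.

Lemma ge0_integral_affine (l : R) b (f : 'rV[R]_N -> \bar R) :
  0 < l -> measurable_fun setT f -> (forall x, 0 <= f x)%E ->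
  (\int[mu]_x f x = (l ^+ N)%:E * \int[mu]_x f (l *: x + b)%R)%E.
Proof.
move=> l0 mf f0.
transitivity (\int[scaled_pushforward (ltW l0) b]_x f x)%E.
  apply: eq_measure_integral => A mA _.
  exact: lebesgue_row_affine.
rewrite ge0_integral_mscale//=; congr (_ * _)%E.
by rewrite ge0_integral_pushforward//; exact: measurable_affine.
Qed.

End row_measurability.

(** * Stability of the class C^1, and the squared positive part *)

Section class_C1.
Context {R : realType} {N : nat}.
Implicit Types (f g : 'rV[R]_N -> R) (x v : 'rV[R]_N).

(** Reduces directional derivatives to one real variable: the two difference quotients are the same
    function of [h]. *)
Lemma derive_line f x v (t : R) :
  ('D_1 (fun s : R => f (s *: v + x)) t = 'D_v f (t *: v + x)) *
  (derivable (fun s : R => f (s *: v + x)) t 1 <-> derivable f (t *: v + x) v).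
Proof.
rewrite /derive /derivable (_ : (fun h : R => h^-1 *: _) =
  (fun h : R => h^-1 *: ((f \o shift (t *: v + x)) (h *: v) - f (t *: v +
    x))))//.
by apply/funext => h /=; rewrite -[h *: 1]/(h * 1) mulr1 scalerDl addrA.
Qed.

Lemma derive_coord (h : R -> R) (i j : 'I_N) x :
  ('D_(delta_mx ord0 j) (fun y : 'rV[R]_N => h (y ord0 i)) x =
     'D_((i == j)%:R) h (x ord0 i)) *
  (derivable (fun y : 'rV[R]_N => h (y ord0 i)) x (delta_mx ord0 j) <->
     derivable h (x ord0 i) (i == j)%:R).
Proof.
rewrite /derive /derivable (_ : (fun s : R => s^-1 *: _) =
  (fun s : R => s^-1 *: ((h \o shift (x ord0 i)) (s *: (i == j)%:R) -
                         h (x ord0 i))))//.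
by apply/funext => s /=; rewrite !mxE eqxx/=.
Qed.

Lemma class_C1_cst (c : R) : class_C 1 ((fun=> c) : 'rV[R]_N -> R).
Proof.
split; first exact: cst_continuous.
move=> i; split; first by move=> x; exact: derivable_cst.
split=> //; rewrite (_ : derive _ ^~ _ = cst 0); first exact: cst_continuous.
by apply/funext => x; rewrite derive_cst.
Qed.

Lemma class_C1_add f g : class_C 1 f -> class_C 1 g -> class_C 1 (f \+ g).
Proof.
move=> [cf df] [cg dg]; split; first by move=> x;
  exact: (continuousD (cf x) (cg x)).
move=> i; have [dfi [cfi _]] := df i; have [dgi [cgi _]] := dg i.
split; first by move=> x; exact: derivableD.
split=> //; rewrite (_ : derive _ ^~ _ =
  'D_(delta_mx ord0 i) f \+ 'D_(delta_mx ord0 i) g).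
  by move=> x; exact: (continuousD (cfi x) (cgi x)).
by apply/funext => x; exact: deriveD.
Qed.

Lemma class_C1_mul f g : class_C 1 f -> class_C 1 g -> class_C 1 (f \* g).
Proof.
move=> [cf df] [cg dg]; split; first by move=> x;
  exact: (continuousM (cf x) (cg x)).
move=> i; have [dfi [cfi _]] := df i; have [dgi [cgi _]] := dg i.
split; first by move=> x; exact: derivableM.
split=> //; rewrite (_ : derive _ ^~ _ =
  (f \* 'D_(delta_mx ord0 i) g) \+ (g \* 'D_(delta_mx ord0 i) f)).
  by move=> x; exact: (continuousD (continuousM (cf x) (cgi x))
    (continuousM (cg x) (cfi x))).
by apply/funext => x; exact: deriveM.
Qed.

Lemma class_C1_scale (c : R) f : class_C 1 f -> class_C 1 (fun x => c * f x).
Proof. by move=> /(class_C1_mul (class_C1_cst c)). Qed.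

Lemma class_C1_sub f g : class_C 1 f -> class_C 1 g -> class_C 1 (f \- g).
Proof.
move=> Cf /(class_C1_scale (-1)) Cg; have := class_C1_add Cf Cg.
by under eq_fun do rewrite /= mulN1r.
Qed.

Lemma class_C1_prod (I : Type) (r : seq I) (F : I -> 'rV[R]_N -> R) :
  (forall i, class_C 1 (F i)) -> class_C 1 (fun x => \prod_(i <- r) F i x).
Proof.
move=> CF; elim: r => [|i r IHr].
  by under eq_fun do rewrite big_nil; exact: class_C1_cst.
by under eq_fun do rewrite big_cons; exact: class_C1_mul.
Qed.

(** Since [f] is only derivable along [v], the chain rule for differentiable maps cannot be applied
    to it. The quotient in question is instead that of the one-variable function [g] in direction
    [l], and the differential of [g] is linear. *)
Lemma is_derive_comp_affine (l : R) x0 f x v :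
  derivable f (l *: x + x0) v ->
  is_derive x v (fun x => f (l *: x + x0)) (l * 'D_v f (l *: x + x0)).
Proof.
move=> df; pose g (s : R) := f (s *: v + (l *: x + x0)).
have dg : derivable g 0 1.
  by apply: (derive_line f (l *: x + x0) v 0).2.2; rewrite scale0r add0r.
have qE : (fun h : R => h^-1 *: (((fun x => f (l *: x + x0)) \o shift x)
    (h *: v) - f (l *: x + x0))) =
    (fun h : R => h^-1 *: ((g \o shift 0) (h *: l) - g 0)).
  apply/funext => h /=; rewrite /g addr0 scale0r add0r; congr (_ *: (f _ - _)).
  by rewrite addrA scalerDr scalerA mulrC.
have dgl : differentiable g 0 by exact/derivable1_diffP.
apply: DeriveDef; first by rewrite /derivable qE; exact: diff_derivable.
rewrite /derive qE -/(derive g 0 l) deriveE//.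
have -> : 'd g 0 l = l *: 'd g 0 1.
  by rewrite -linearZ/= -[l *: 1]/(l * 1) mulr1.
by rewrite -deriveE// (derive_line f (l *: x + x0) v 0).1 scale0r add0r.
Qed.

Lemma class_C1_comp_affine (l : R) x0 f :
  class_C 1 f -> class_C 1 (fun x => f (l *: x + x0)).
Proof.
move=> [cf df].
have ca : continuous (fun x : 'rV[R]_N => l *: x + x0).
  move=> x; apply: (@continuousD _ _ _ (fun y : 'rV[R]_N => l *: y) (cst x0)).
    exact: scaler_continuous.
  exact: cst_continuous.
have cfa g : continuous g -> continuous (fun x => g (l *: x + x0)).
  by move=> cg x; apply: (continuous_comp (ca x)); exact: cg.
split; first exact: cfa.
move=> i; have [dfi [cfi _]] := df i.
have dE x := is_derive_comp_affine (dfi (l *: x + x0)).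
split=> [x|]; first by have [] := dE x.
split=> //.
have cl : continuous (cst l : 'rV[R]_N -> R) by exact: cst_continuous.
have H x := continuousM (cl x) (cfa _ cfi x).
rewrite (_ : derive _ ^~ _ =
  fun x => l * 'D_(delta_mx ord0 i) f (l *: x + x0)).
  exact: H.
by apply/funext => x; exact: derive_val.
Qed.

(** The first-order Taylor error over a step [h] is at most [(s * h) ^+ 2], even across the kink.
    This function is the building block of the bumps. *)
Lemma is_derive_sqr_max0 (s c t : R) :
  is_derive t 1 (fun t => Num.max 0 (s * t + c) ^+ 2)
    (2 * s * Num.max 0 (s * t + c)).
Proof.
pose f t := Num.max 0 (s * t + c) ^+ 2; rewrite -/f; set l : R := 2 * s * _.
suff dl : (fun h : R => h^-1 *: ((f \o shift t) (h *: 1) - f t)) @ 0^' --> l.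
  apply: DeriveDef; last exact/cvg_lim.
  by apply/cvg_ex; eexists; exact: dl.
apply/cvgrPdist_le => e e0; near=> h.
have h0 : h != 0 by near: h; exact: nbhs_dnbhs_neq.
have he : s ^+ 2 * `|h| <= e.
  have : `|h| <= e / (s ^+ 2 + 1).
    by near: h; apply: dnbhs0_le; rewrite divr_gt0// ltr_wpDl// sqr_ge0.
  rewrite ler_pdivlMr ?ltr_wpDl ?sqr_ge0// mulrC; apply: le_trans.
  by rewrite ler_wpM2r// lerDl.
apply: le_trans he.
rewrite /= -[h *: 1]/(h * 1) mulr1 -[_ *: _]/(_ * _) /f /l.
set y := s * t + c; set k := s * h.
have -> : s * (h + t) + c = y + k by rewrite /y /k; ring.
rewrite -(ler_pM2l (x := `|h|)) ?normr_gt0// -normrM mulrBr (mulrA h h^-1)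
  divff// mul1r.
have -> : `|h| * (s ^+ 2 * `|h|) = k ^+ 2.
  by rewrite mulrCA -expr2 real_normK ?num_real// -exprMn.
have -> : h * (2 * s * Num.max 0 y) = 2 * k * Num.max 0 y by rewrite /k; ring.
(* A quadratic inequality in [y] and [k], checked for each choice of signs of [y] and [y + k]. *)
by rewrite ler_norml /Num.max; case: ifPn; case: ifPn; rewrite -?leNgt => *;
  apply/andP; split; nra.
Unshelve. all: by end_near. Qed.

Lemma class_C1_sqr_max0 (s c : R) (i : 'I_N) :
  class_C 1 (fun x : 'rV[R]_N => Num.max 0 (s * x ord0 i + c) ^+ 2).
Proof.
have cmax : continuous (fun t : R => Num.max 0 (s * t + c)).
  have c0 : continuous (cst 0 : R -> R^o) by exact: cst_continuous.
  have cc : continuous (cst c : R -> R) by exact: cst_continuous.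
  have cs : continuous (fun t : R => s * t) by exact: mulrl_continuous.
  by move=> t; exact: (continuous_max (c0 t) (continuousD (cs t) (cc t))).
have cx (g : R -> R) : continuous g ->
    continuous (fun x : 'rV[R]_N => g (x ord0 i)).
  by move=> cg x; apply: (continuous_comp (@coord_continuous _ _ _ _ _ x));
    exact: cg.
have cmax2 : continuous (fun t : R => Num.max 0 (s * t + c) ^+ 2).
  by move=> t; exact: (continuousM (cmax t) (cmax t)).
split; first exact: cx cmax2.
move=> j.
pose d (x : 'rV[R]_N) := (i == j)%:R * (2 * s * Num.max 0 (s * x ord0 i + c)).
have dE x : is_derive x (delta_mx ord0 j)
    (fun x : 'rV[R]_N => Num.max 0 (s * x ord0 i + c) ^+ 2) (d x).
  have [Dd dd] := derive_coord (fun t => Num.max 0 (s * t + c) ^+ 2) i j x.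
  rewrite /d; move: Dd dd; case: (i == j) => Dd dd.
    have [dq Dq] := is_derive_sqr_max0 s c (x ord0 i).
    by apply: DeriveDef; [exact: dd.2|rewrite Dd Dq mul1r].
  apply: DeriveDef; first by apply: dd.2; exact: derivable0.
  by rewrite Dd derive0 mul0r.
split=> [x|]; first by have [] := dE x.
split=> //; rewrite (_ : derive _ ^~ _ = d); last first.
  by apply/funext => x; exact: derive_val.
have ck k : continuous (cst k : R -> R) by exact: cst_continuous.
apply: (cx (fun t => (i == j)%:R * (2 * s * Num.max 0 (s * t + c)))) => t.
exact: (continuousM (ck _ t) (continuousM (ck _ t) (cmax t))).
Qed.

End class_C1.

(** * Bounded support, and the vanishing integral of a derivative *)

Section compact_support.
Context {R : realType} {N : nat}.
Local Notation mu := (lebesgue_row R N).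
Implicit Types (f g u : 'rV[R]_N -> R) (x : 'rV[R]_N).

Definition supported u := exists r : R, forall x, r <= `|x| -> u x = 0.

Lemma supported_pos u : supported u ->
  exists2 r : R, 0 < r & forall x, r <= `|x| -> u x = 0.
Proof.
move=> [r ur]; exists (Num.max r 1); first by rewrite lt_max ltr01 orbT.
by move=> x; rewrite ge_max => /andP[/ur].
Qed.

Lemma supportedMl f g : supported f -> supported (f \* g).
Proof. by move=> [r fr]; exists r => x /fr /= ->; rewrite mul0r. Qed.

Lemma supportedD f g : supported f -> supported g -> supported (f \+ g).
Proof.
move=> [r fr] [s gs]; exists (Num.max r s) => x.
by rewrite ge_max => /andP[/fr/= -> /gs ->]; rewrite addr0.
Qed.

Lemma compact_norm_le (r : R) : compact [set x : 'rV[R]_N | `|x| <= r].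
Proof.
apply: bounded_closed_compact.
  by exists r; split; [exact: num_real|move=> s rs x /= /le_trans; apply;
    exact: ltW].
rewrite (_ : mkset _ = closed_ball_ Num.norm 0 r);
  first exact: closed_closed_ball_.
by apply/seteqP; split=> x; rewrite /closed_ball_/= sub0r normrN.
Qed.

Lemma continuous_supported_bounded f : continuous f -> supported f ->
  exists2 C : R, 0 <= C & forall x, `|f x| <= C.
Proof.
move=> cf [r fr].
have /compact_bounded[M [Mr fM]] : compact (f @` [set x | `|x| <= r]).
  apply: continuous_compact; last exact: compact_norm_le.
  by apply: continuous_subspaceT => x; exact: cf.
have M0 : 0 <= `|M| + 1 by rewrite addr_ge0.
exists (`|M| + 1) => //.
move=> x; have [xr|rx] := leP `|x| r.
  by apply: fM; [rewrite (le_lt_trans (ler_norm M))// ltrDl|exists x].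
by rewrite fr ?ltW// normr0.
Qed.

Lemma derive_supported f i : supported f -> supported ('D_(delta_mx ord0 i) f).
Proof.
(* Beyond radius [r + 1] the function vanishes on a whole neighbourhood of the point, so its
   derivative there is that of a constant. *)
move=> [r fr]; exists (r + 1) => x rx.
rewrite (@near_eq_derive _ _ _ f (cst 0)) ?derive_cst//.
have rx1 : r < `|x| by rewrite (lt_le_trans _ rx)// ltrDl.
near=> y; apply: fr; apply: ltW; near: y.
exact: (@cvgr_norm_gt _ _ _ (nbhs x) _ id x _ _ rx1).
Unshelve. all: by end_near. Qed.

Lemma integrable_indic_cube (r : R) : mu.-integrable setT (EFin \o \1_(cube r)).
Proof.
have mc : measurable (cube r : set 'rV[R]_N) by exact: measurable_box.
apply/integrableP; split; first exact/measurable_EFinP/measurable_indic.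
under eq_integral do rewrite /= ger0_norm//.
by rewrite integral_indic// setIT; exact: lebesgue_cube_lty.
Qed.

Lemma supported_integrable f (C : R) : measurable_fun setT f -> supported f ->
  (forall x, `|f x| <= C) -> mu.-integrable setT (EFin \o f).
Proof.
move=> mf /supported_pos[r r0 fr] fC.
have /(integrableZl measurableT C) := integrable_indic_cube r.
apply: le_integrable => //; first exact/measurable_EFinP.
move=> x _; rewrite /= lee_fin indicE.
have [xr|rx] := ltP `|x| r; last by rewrite fr// normr0.
by rewrite mem_set ?mulr1 ?(le_trans (fC x) (ler_norm _))//; apply/cubeP.
Qed.

Lemma integral_translation f v : measurable_fun setT f ->
  (\int[mu]_x (f (x + v))%:E = \int[mu]_x (f x)%:E)%E.
Proof.
move=> /measurable_EFinP mf.
have ge0 (g : 'rV[R]_N -> \bar R) : measurable_fun setT g ->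
    (forall x, 0 <= g x)%E -> (\int[mu]_x g (x + v)%R = \int[mu]_x g x)%E.
  move=> mg g0; rewrite [RHS](ge0_integral_affine v ltr01)// expr1n mul1e.
  by apply: eq_integral => x _; rewrite scale1r.
rewrite integralE [RHS]integralE; congr (_ - _)%E.
  rewrite -(ge0 _ (measurable_funepos mf) (fun x => funepos_ge0 _ x)).
  by apply: eq_integral => x _; rewrite funepos.unlock.
rewrite -(ge0 _ (measurable_funeneg mf) (fun x => funeneg_ge0 _ x)).
by apply: eq_integral => x _; rewrite funeneg.unlock.
Qed.

Lemma lipschitz_line f v (C : R) x (h : R) :
  (forall y, derivable f y v) -> (forall y, `|'D_v f y| <= C) ->
  `|f (h *: v + x) - f x| <= C * `|h|.
Proof.
move=> df fC.
pose g (s : R) := f (s *: v + x).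
have dg (t : R) : is_derive t 1 g ('D_v f (t *: v + x)).
  by have [Dl dl] := derive_line f x v t; apply: DeriveDef => //; exact: dl.2.
have cg : continuous g.
  by move=> t; exact/differentiable_continuous/derivable1_diffP.
have mvt (a b : R) : a <= b -> `|g b - g a| <= C * (b - a).
  move=> ab; have [|c _ ->] := MVT_segment ab (fun t _ => dg t).
    exact: continuous_subspaceT.
  by rewrite normrM (ger0_norm (_ : 0 <= b - a)) ?subr_ge0// ler_wpM2r//
    subr_ge0.
have -> : f x = g 0 by rewrite /g scale0r add0r.
rewrite -/(g h); have [h0|h0] := leP 0 h.
  by rewrite (ger0_norm h0) -[X in C * X]subr0 mvt.
by rewrite distrC (ltr0_norm h0) -[X in C * X]sub0r mvt// ltW.
Qed.

(** The difference quotients [q n] have integral zero by translation invariance, converge pointwise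
    to the derivative, and by the mean value theorem are bounded by [C] on a fixed cube, outside
    which they vanish. Dominated convergence concludes. *)
Lemma integral_derive f i : class_C 1 f -> supported f ->
  (\int[mu]_x ('D_(delta_mx ord0 i) f x)%:E = 0)%E.
Proof.
set e := delta_mx ord0 i => -[cf dfc] sf.
have [df [cDf _]] := dfc i.
have [C C0 DfC] := continuous_supported_bounded cDf (derive_supported i sf).
have [B _ fB] := continuous_supported_bounded cf sf.
pose q n x : R := n.+1%:R * (f (n.+1%:R^-1 *: e + x) - f x).
have [r r0 fr] := supported_pos sf.
have ce n : continuous (fun x : 'rV[R]_N => (n.+1%:R^-1 : R) *: e + x).
  have c1 : continuous (cst ((n.+1%:R^-1 : R) *: e) : 'rV[R]_N -> 'rV[R]_N).
    exact: cst_continuous.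
  have c2 : continuous (id : 'rV[R]_N -> 'rV[R]_N) by move=> x; exact: cvg_id.
  by move=> x; exact: (continuousD (c1 x) (c2 x)).
have cfe n : continuous (fun x : 'rV[R]_N => f ((n.+1%:R^-1 : R) *: e + x)).
  by move=> x; apply: (continuous_comp (ce n x)); exact: cf.
have mf := continuous_row_measurable cf.
have mfe n := continuous_row_measurable (cfe n).
(* All the shifts have norm at most that of [e], so one enlarged radius serves every [n]. *)
have vanish n x : r + `|e| <= `|x| ->
    f x = 0 /\ f (n.+1%:R^-1 *: e + x) = 0.
  move=> rx; split; apply: fr.
    by rewrite (le_trans _ rx)// lerDl.
  have : `|n.+1%:R^-1 *: e| <= `|e|.
    by rewrite normrZ ger0_norm// ler_piMl// invf_le1// ler1n.
  have := ler_normB (n.+1%:R^-1 *: e + x) (n.+1%:R^-1 *: e).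
  by rewrite addrAC subrr add0r; lra.
have iF := supported_integrable mf sf fB.
have iFe n : mu.-integrable setT (EFin \o (fun x => f (n.+1%:R^-1 *: e + x))).
  apply: (supported_integrable (mfe n)) => [|x]; last exact: fB.
  by exists (r + `|e|) => x /(vanish n)[].
have q0 n : (\int[mu]_x (q n x)%:E = 0)%E.
  under eq_integral do rewrite EFinM EFinB.
  rewrite integralZl//=; last exact: (integrableB measurableT (iFe n) iF).
  rewrite (integralB_EFin measurableT (iFe n) iF).
  under eq_integral do rewrite addrC.
  rewrite integral_translation// subee ?mule0//.
  exact: (integrable_fin_num measurableT iF).
have mDf := continuous_row_measurable cDf.
have qD x : setT x -> (fun n => (q n x)%:E) @ \oo --> ('D_e f x)%:E.
  move=> _; apply: cvg_EFin; first by near=> n.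
  have h0 : (fun n : nat => n.+1%:R^-1 : R) @ \oo --> 0^'.
    move=> A A0; apply: (@filterS _ \oo _ _ _ _ (@cvg_harmonic R _ A0)) => n /=.
    by apply; rewrite invr_eq0 pnatr_eq0.
  have := cvg_comp _ _ h0 (df x).
  apply: cvg_trans; apply: near_eq_cvg; near=> n.
  by rewrite /= /q invrK.
have iG := integrableZl measurableT C (integrable_indic_cube (r + `|e|)).
have /(_ _ _ _)/cvg_lim := dominated_cvg measurableT _ qD _ iG _.
move=> <-//.
- by under eq_fun do rewrite q0; rewrite lim_cst.
- move=> n; apply/measurable_EFinP; apply: measurable_funM => //.
  exact: measurable_funB.
- move=> n x _; rewrite lee_fin /= /q.
  have [xr|rx] := ltP `|x| (r + `|e|).
    rewrite indicE mem_set ?mulr1; last by apply/cubeP => //; rewrite ltr_wpDr.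
    have := lipschitz_line x n.+1%:R^-1 df DfC.
    rewrite normrM ger0_norm// (ger0_norm (_ : 0 <= n.+1%:R^-1))//.
    by rewrite ler_pdivlMr// mulrC.
  have [fx0 fxe0] := vanish n x rx.
  by rewrite fx0 fxe0 subr0 mulr0 normr0 mulr_ge0.
Unshelve. all: by end_near. Qed.

End compact_support.

(** * Squared L^2 norms *)

Section square_integral.
Context d (T : measurableType d) {R : realType}.
Variable mu : {measure set T -> \bar R}.
Implicit Types f g : T -> R.

Definition sqint f : \bar R := (\int[mu]_x (f x ^+ 2)%:E)%E.

Lemma sqint_ge0 f : (0 <= sqint f)%E.
Proof. by apply: integral_ge0 => x _; rewrite lee_fin sqr_ge0. Qed.

Lemma measurable_EFin_sqr f : measurable_fun setT f ->
  measurable_fun setT (fun x => (f x ^+ 2)%:E).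
Proof. by move=> mf; apply/measurable_EFinP; exact: measurable_funX. Qed.
Hint Resolve measurable_EFin_sqr : core.

Lemma Lfun2P f :
  f \in Lfun mu 2%:E <-> measurable_fun setT f /\ (sqint f < +oo)%E.
Proof.
split=> [f2|[mf foo]].
  split; first by move: f2; rewrite inE => /andP[/[!inE]].
  have /integrableP[_] := Lfun2_integrable_sqr f2.
  by under eq_integral do rewrite /= ger0_norm ?sqr_ge0//.
rewrite inE; apply/andP; split; rewrite inE//= /finite_norm unlock.
rewrite poweR_lty//; apply: le_lt_trans foo; rewrite le_eqVlt; apply/orP; left.
apply/eqP; apply: eq_integral => x _.
by rewrite /= powR_mulrn// real_normK ?num_real.
Qed.

Lemma sqint_scale (c : R) f : measurable_fun setT f ->
  sqint (fun x => c * f x) = ((c ^+ 2)%:E * sqint f)%E.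
Proof.
move=> mf; rewrite /sqint -ge0_integralZl_EFin ?sqr_ge0//.
- by apply: eq_integral => x _; rewrite exprMn EFinM.
- by move=> x _; rewrite lee_fin sqr_ge0.
- exact: measurable_EFin_sqr.
Qed.

(** Integrated form of 2fg <= e f^2 + g^2/e. A small [e] keeps the coefficient of [sqint f] close to
    1, on which the norm bound of [riesz_energy_approx] relies. *)
Lemma sqint_add (e : R) f g : 0 < e ->
  measurable_fun setT f -> measurable_fun setT g ->
  (sqint (f \+ g)%R <= (1 + e)%:E * sqint f + (1 + e^-1)%:E * sqint g)%E.
Proof.
move=> e0 mf mg; have mf2 := measurable_EFin_sqr mf.
have mg2 := measurable_EFin_sqr mg.
have e1 : 0 <= 1 + e by rewrite addr_ge0// ltW.
have e2 : 0 <= 1 + e^-1 by rewrite addr_ge0// invr_ge0 ltW.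
rewrite -!ge0_integralZl_EFin//; try by move=> x _; rewrite lee_fin sqr_ge0.
rewrite -ge0_integralD//; first last.
- exact: measurable_funeM.
- by move=> x _; rewrite -EFinM lee_fin mulr_ge0// sqr_ge0.
- exact: measurable_funeM.
- by move=> x _; rewrite -EFinM lee_fin mulr_ge0// sqr_ge0.
apply: ge0_le_integral => //.
- by move=> x _; rewrite lee_fin sqr_ge0.
- by apply: measurable_EFin_sqr; exact: measurable_funD.
- by apply: emeasurable_funD; exact: measurable_funeM.
move=> x _; rewrite -!EFinM -EFinD lee_fin -subr_ge0 /=.
rewrite (_ : _ - _ = e * (f x - e^-1 * g x) ^+ 2).
  by rewrite mulr_ge0// ?sqr_ge0// ltW.
by field; rewrite gt_eqF.
Qed.

Lemma sqint_dominated (f_ : nat -> T -> R) f g (e : R) : 0 < e ->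
  (forall n, measurable_fun setT (f_ n)) -> measurable_fun setT f ->
  (forall x, f_ ^~ x @ \oo --> f x) -> mu.-integrable setT (EFin \o g) ->
  (forall n x, (f x - f_ n x) ^+ 2 <= g x) ->
  exists n, (sqint (f \- f_ n)%R <= e%:E)%E.
Proof.
move=> e0 mf_ mf f_f ig fg.
have h x : setT x -> (fun n => ((f x - f_ n x) ^+ 2)%:E) @ \oo --> (cst 0%E x :
  \bar R).
  move=> _; apply: cvg_EFin; first by near=> n.
  rewrite /comp/=.
  have c : (fun n => f x - f_ n x) @ \oo --> (0 : R).
    by rewrite -[X in _ --> X](subrr (f x)); apply: cvgB;
      [exact: cvg_cst|exact: f_f].
  by rewrite -(mulr0 (0 : R)); exact: cvgM.
have m n : measurable_fun setT (fun x => ((f x - f_ n x) ^+ 2)%:E).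
  by apply: measurable_EFin_sqr; exact: measurable_funB.
have fg' n x : setT x -> (`|((f x - f_ n x) ^+ 2)%:E| <= (EFin \o g) x)%E.
  by move=> _; rewrite /= lee_fin ger0_norm ?sqr_ge0.
have gfin x : setT x -> (EFin \o g) x \is a fin_num by [].
have /(_ [set y | (y < e%:E)%E]) :=
  dominated_cvg measurableT m h gfin ig fg'.
rewrite integral0 => /(_ (open_ereal_lt' _))[|n _ /(_ n (leqnn n)) ne].
  by rewrite lte_fin.
by exists n; exact: ltW.
Unshelve. all: by end_near. Qed.

End square_integral.

(** * C^1 functions with bounded support and their L^2 closure *)

Section C1c.
Context {R : realType} {N : nat}.
Local Notation mu := (lebesgue_row R N).
Implicit Types (f g u : 'rV[R]_N -> R) (x : 'rV[R]_N).

Definition class_C1c u := class_C 1 u /\ supported u.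

Lemma continuous_supported_integrable f : continuous f -> supported f ->
  mu.-integrable setT (EFin \o f).
Proof.
move=> cf sf; have [C _ fC] := continuous_supported_bounded cf sf.
exact: (supported_integrable (continuous_row_measurable cf) sf fC).
Qed.

Lemma continuous_supported_Lfun2 f : continuous f -> supported f ->
  f \in Lfun mu 2%:E.
Proof.
move=> cf sf; apply/Lfun2P; split; first exact: continuous_row_measurable.
have cf2 : continuous (f \* f) by move=> x; exact: (continuousM (cf x) (cf x)).
have /integrableP[_] := continuous_supported_integrable cf2 (supportedMl f sf).
by under eq_integral do rewrite /= -expr2 ger0_norm ?sqr_ge0//.
Qed.

(** The derivative of [u * phi] has integral zero, and the product rule turns this into the defining
    identity of the weak gradient. The derivatives of [u] are continuous with bounded support, hence
    in L^2. *)
Lemma class_C1c_H1_gradient u : class_C1c u ->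
  H1_gradient u (fun x => \row_i 'D_(delta_mx ord0 i) u x).
Proof.
move=> [Cu su]; have [cu du] := Cu; split=> [phi [Cphi _] i|i]; last first.
  under eq_fun do rewrite mxE; have [_ [cdu _]] := du i.
  exact/continuous_supported_Lfun2/derive_supported.
have [dui [cdu _]] := du i.
have C1phi := Cphi 1; have [cphi dphi] := C1phi.
have [dphii [cdphi _]] := dphi i.
under [in RHS]eq_Rintegral do rewrite mxE.
have := integral_derive i (class_C1_mul Cu C1phi) (supportedMl phi su).
under eq_integral.
  move=> x _; rewrite (_ : 'D_ _ _ x = u x * 'D_(delta_mx ord0 i) phi x +
    'D_(delta_mx ord0 i) u x * phi x); first over.
  by rewrite (deriveM (dui x) (dphii x)) [X in _ + X]mulrC.
move=> /(congr1 fine); rewrite -/(Rintegral _ _ _) RintegralD//.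
- by move/eqP; rewrite addr_eq0 => /eqP.
- apply: continuous_supported_integrable; last exact: supportedMl.
  by move=> x; exact: (continuousM (cu x) (cdphi x)).
- apply: continuous_supported_integrable.
    by move=> x; exact: (continuousM (cdu x) (cphi x)).
  exact/supportedMl/derive_supported.
Qed.

Lemma class_C1c_measurable u : class_C1c u -> measurable_fun setT u.
Proof. by move=> [[cu _] _]; exact: continuous_row_measurable. Qed.

Lemma sqint_add_le f g (s t : R) :
  measurable_fun setT f -> measurable_fun setT g ->
  (sqint mu f <= s%:E)%E -> (sqint mu g <= t%:E)%E ->
  (sqint mu (f \+ g)%R <= (2 * s + 2 * t)%:E)%E.
Proof.
move=> mf mg fs gt; apply: le_trans (sqint_add mu ltr01 mf mg) _.
rewrite invr1 (_ : 1 + 1 = 2)// (EFinD (2 * s)) !EFinM.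
by apply: leeD; apply: lee_wpmul2l.
Qed.

(** The closure of [class_C1c] for the L^2 distance. The distance is kept squared, so errors are
    combined by [sqint_add_le], at the cost of a factor 2. *)
Definition approximable f := measurable_fun setT f /\
  forall e : R, 0 < e ->
    exists2 v, class_C1c v & (sqint mu (f \- v)%R <= e%:E)%E.

Lemma class_C1c_add f g : class_C1c f -> class_C1c g -> class_C1c (f \+ g).
Proof.
by move=> [Cf sf] [Cg sg]; split; [exact: class_C1_add|exact: supportedD].
Qed.

Lemma class_C1c_scale (c : R) f : class_C1c f -> class_C1c (fun x => c * f x).
Proof.
move=> [Cf [r fr]]; split; first exact: class_C1_scale.
by exists r => x /fr ->; rewrite mulr0.
Qed.

Lemma approximable_cst0 : approximable (cst 0).
Proof.
split=> // e e0; exists (cst 0); first by split; [exact: class_C1_cst|exists 0].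
rewrite /sqint integral0_eq ?lee_fin ?ltW// => x _ /=.
by rewrite subr0 expr0n.
Qed.

Lemma approximable_lim f : measurable_fun setT f ->
  (forall e : R, 0 < e ->
    exists2 g, approximable g & (sqint mu (f \- g)%R <= e%:E)%E) ->
  approximable f.
Proof.
move=> mf fa; split=> // e e0.
(* Both errors get doubled by [sqint_add_le], and 2 (e/4) + 2 (e/4) = e. *)
have [|g [mg ga] fg] := fa (e / 4); first by rewrite divr_gt0.
have [|v Cv gv] := ga (e / 4); first by rewrite divr_gt0.
have mv := class_C1c_measurable Cv.
exists v => //; have -> : (f \- v = (f \- g) \+ (g \- v))%R.
  by apply/funext => x /=; rewrite addrA subrK.
have := sqint_add_le (measurable_funB mf mg) (measurable_funB mg mv) fg gv.
by move/le_trans; apply; rewrite lee_fin; lra.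
Qed.

Lemma approximable_scale (c : R) f : approximable f ->
  approximable (fun x => c * f x).
Proof.
move=> [mf fa]; split; first exact: measurable_funM.
(* The added 1 keeps the divisor positive when [c = 0]. *)
move=> e e0; have c0 : 0 < c ^+ 2 + 1 by rewrite ltr_wpDl// sqr_ge0.
have [|v Cv fv] := fa (e / (c ^+ 2 + 1)); first by rewrite divr_gt0.
exists (fun x => c * v x); first exact: class_C1c_scale.
rewrite (_ : (_ \- _)%R = fun x => c * (f \- v) x); last first.
  by apply/funext => x /=; rewrite mulrBr.
rewrite sqint_scale; last first.
  by apply: measurable_funB => //; exact: class_C1c_measurable.
have : ((c ^+ 2)%:E * sqint mu (f \- v)%R <=
    (c ^+ 2)%:E * (e / (c ^+ 2 + 1))%:E)%E.
  by rewrite lee_wpmul2l// lee_fin sqr_ge0.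
move/le_trans; apply; rewrite -EFinM lee_fin.
by rewrite mulrCA ler_piMr ?(ltW e0)// ler_pdivrMr// mul1r lerDl.
Qed.

Lemma approximable_add f g : approximable f -> approximable g ->
  approximable (f \+ g).
Proof.
move=> [mf fa] [mg ga]; split; first exact: measurable_funD.
move=> e e0.
have [|v Cv fv] := fa (e / 4); first by rewrite divr_gt0.
have [|w Cw gw] := ga (e / 4); first by rewrite divr_gt0.
have mv := class_C1c_measurable Cv; have mw := class_C1c_measurable Cw.
exists (v \+ w); first exact: class_C1c_add.
have -> : ((f \+ g) \- (v \+ w) = (f \- v) \+ (g \- w))%R.
  by apply/funext => x /=; rewrite opprD addrACA.
have := sqint_add_le (measurable_funB mf mv) (measurable_funB mg mw) fv gw.
by move/le_trans; apply; rewrite lee_fin; lra.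
Qed.

Lemma approximable_sub f g : approximable f -> approximable g ->
  approximable (f \- g).
Proof.
move=> fa /(approximable_scale (-1)) ga; have := approximable_add fa ga.
by under eq_fun do rewrite /= mulN1r.
Qed.

Lemma approximable_sum (I : Type) (r : seq I) (F : I -> 'rV[R]_N -> R) :
  (forall i, approximable (F i)) -> approximable (fun x => \sum_(i <- r) F i x).
Proof.
move=> aF; elim: r => [|i r IHr].
  by under eq_fun do rewrite big_nil; exact: approximable_cst0.
by under eq_fun do rewrite big_cons; exact: approximable_add.
Qed.

Lemma approximable_dominated (f_ : nat -> 'rV[R]_N -> R) f g :
  (forall n, approximable (f_ n)) -> measurable_fun setT f ->
  (forall x, f_ ^~ x @ \oo --> f x) -> mu.-integrable setT (EFin \o g) ->
  (forall n x, (f x - f_ n x) ^+ 2 <= g x) ->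
  approximable f.
Proof.
move=> fa mf f_f ig fg; apply: approximable_lim => // e e0.
have [n fn] := sqint_dominated e0 (fun n => (fa n).1) mf f_f ig fg.
by exists (f_ n).
Qed.

Lemma class_C1c_approximable v : class_C1c v -> approximable v.
Proof.
move=> Cv; split=> [|e e0]; first exact: class_C1c_measurable.
exists v => //; rewrite /sqint integral0_eq ?lee_fin ?ltW// => x _ /=.
by rewrite subrr expr0n.
Qed.

End C1c.

(** * Density in L^2: from boxes to measurable sets to nonnegative functions *)

Section density.
Context {R : realType} {N : nat}.
Local Notation mu := (lebesgue_row R N).
Implicit Types (f g u : 'rV[R]_N -> R) (a b x : 'rV[R]_N).

Lemma box_norm_lt a b x : box a b x -> `|x| < `|a| + `|b| + 1.
Proof.
move=> xab; apply/ltr_normrV; first by rewrite ltr_wpDl// addr_ge0.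
move=> i; have := xab i; rewrite in_itv/= => /andP[axi xbi].
have := ler_coord_norm a i; have := ler_coord_norm b i.
by rewrite !ler_norml ltr_norml => /andP[? ?] /andP[? ?]; apply/andP; split;
  lra.
Qed.

Lemma class_C1_expn f n : class_C 1 f -> class_C 1 (fun x => f x ^+ n).
Proof.
move=> Cf; elim: n => [|n IHn].
  by under eq_fun do rewrite expr0; exact: class_C1_cst.
by under eq_fun do rewrite exprS; exact: class_C1_mul.
Qed.

(** The product over the coordinates of the squared positive parts of x_i - a_i and b_i - x_i is C^1
    and positive exactly on the box. Dividing it by a bound plus one makes it strictly less than
    1. *)
Lemma C1_bump a b : exists h : 'rV[R]_N -> R, [/\ class_C 1 h,
  forall x, 0 <= h x < 1 & forall x, box a b x <-> 0 < h x].
Proof.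
pose q i x : R := Num.max 0 (1 * x ord0 i + - a ord0 i) ^+ 2 *
  Num.max 0 (-1 * x ord0 i + b ord0 i) ^+ 2.
pose h0 x := \prod_(i < N) q i x.
have Ch0 : class_C 1 h0.
  by apply: class_C1_prod => i; apply: class_C1_mul; exact: class_C1_sqr_max0.
have max2 (y : R) : 0 <= Num.max 0 y ^+ 2 by rewrite sqr_ge0.
have h00 x : 0 <= h0 x by apply: prodr_ge0 => i _; rewrite mulr_ge0.
have h0P x : box a b x <-> 0 < h0 x.
  split=> [xab|].
    apply: prodr_gt0 => i _; have := xab i; rewrite in_itv/= => /andP[ax xb].
    by rewrite mulr_gt0// exprn_gt0// lt_max; apply/orP; right; lra.
  move=> h0x i; have : q i x != 0.
    by move: h0x; rewrite lt0r => /andP[/prodf_neq0/(_ i isT)].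
  rewrite mulf_eq0 !expf_eq0/= negb_or in_itv/= => /andP[+ +].
  rewrite /Num.max; case: ifPn => [ax _|_]; last by rewrite eqxx.
  by case: ifPn => [xb _|_]; [apply/andP; split; lra|rewrite eqxx].
have sh0 : supported h0.
  exists (`|a| + `|b| + 1) => x; rewrite leNgt; apply: contraNeq => h0x.
  by apply/box_norm_lt/h0P; rewrite lt0r h0x h00.
have [C C0 h0C] := continuous_supported_bounded Ch0.1 sh0.
have C1 : 0 < C + 1 by rewrite ltr_wpDl.
exists (fun x => (C + 1)^-1 * h0 x); split.
- exact: class_C1_scale.
- move=> x; rewrite mulr_ge0//=; last by rewrite invr_ge0 ltW.
  rewrite mulrC ltr_pdivrMr// mul1r (le_lt_trans (ler_norm _))//.
  by rewrite (le_lt_trans (h0C x))// ltrDl.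
- by move=> x; rewrite h0P pmulr_rgt0// invr_gt0.
Qed.

(** The functions [1 - (1 - h x) ^+ n] tend to the indicator: on the box 0 < h < 1, so the powers
    tend to 0, and off the box h = 0. *)
Lemma approximable_box a b : approximable (\1_(box a b) : 'rV[R]_N -> R).
Proof.
have [h [Ch h01 hP]] := C1_bump a b.
have h0 x : ~ box a b x -> h x = 0.
  move=> xab; apply/eqP; rewrite eq_le; have /andP[-> _] := h01 x.
  by rewrite andbT leNgt; apply/negP => /hP.
pose r : R := `|a| + `|b| + 1.
have sub : box a b `<=` cube r.
  by move=> x /box_norm_lt xr; apply/cubeP => //; exact: le_lt_trans xr.
apply: (@approximable_dominated _ _ (fun n x =>
  1 - (1 - h x) ^+ n) _ (\1_(cube r))).
- move=> n; apply: class_C1c_approximable; split.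
    by apply: class_C1_sub (class_C1_cst 1) (class_C1_expn _ _);
      exact: class_C1_sub (class_C1_cst 1) _.
  exists r => x rx; rewrite h0 ?subr0 ?expr1n ?subrr// => /box_norm_lt.
  by rewrite ltNge rx.
- by apply: measurable_indic; exact: measurable_box.
- move=> x; rewrite indicE; have [xab|xab] := pselect (box a b x); last first.
    rewrite memNset//; under eq_fun do rewrite h0// subr0 expr1n subrr.
    exact: cvg_cst.
  rewrite mem_set//= -[X in _ --> X]subr0; apply: cvgB; first exact: cvg_cst.
  apply: cvg_expr; have /andP[hx0 hx1] := h01 x; have hx := (hP x).1 xab.
  by rewrite ger0_norm ?subr_ge0 ?(ltW hx1)// ltrBlDr ltrDl.
- exact: integrable_indic_cube.
- move=> n x; rewrite !indicE; have [xab|xab] := pselect (box a b x).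
    rewrite !mem_set//; last exact: sub.
    have /andP[hx0 hx1] := h01 x.
    by rewrite opprB addrC subrK -exprM exprn_ile1// ?lerBlDr ?lerDl// subr_ge0
      ltW.
  by rewrite memNset//= h0// subr0 expr1n subrr subrr expr0n.
Qed.

(** Dynkin's argument: the sets with approximable trace on the cube form a lambda-system containing
    the boxes. Cutting with the cube keeps all the indicators below one integrable function, which
    dominates in the limit of an increasing union. *)
Lemma approximable_indic_cube E (r : R) : measurable E ->
  approximable (\1_(E `&` cube r) : 'rV[R]_N -> R).
Proof.
pose H := [set E : set 'rV[R]_N |
  measurable E /\ approximable (\1_(E `&` cube r) : 'rV[R]_N -> R)].
have mc : measurable (cube r : set 'rV[R]_N) by exact: measurable_box.
rewrite measurable_rowE => /(_ : _ `<=` H) [].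
- apply: lambda_system_subset => //; first exact: setI_closed_boxes.
  split=> //.
  + by split=> //; rewrite setTI; exact: approximable_box.
  + move=> A B BA [mA aA] [mB aB]; split; first exact: measurableD.
    have := approximable_sub aA aB; congr approximable; apply/funext => x /=.
    rewrite !indicE !in_setI classical_sets.in_setC.
    have [xA|xA] := boolP (x \in A); have [xB|xB] := boolP (x \in B);
      case: (x \in cube r) => //=; rewrite ?subrr ?subr0//.
    by move: xA; rewrite inE in xB; rewrite mem_set//; exact: BA.
  + move=> F ndF mF; have mU : measurable (\bigcup_i F i).
      by apply: bigcupT_measurable => k; have [] := mF k.
    split=> //; apply: (@approximable_dominated _ _
        (fun n => \1_(F n `&` cube r)) _ (\1_(cube r))).
    * by move=> n; have [] := mF n.
    * by apply: measurable_indic; exact: measurableI.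
    * move=> x; rewrite indicE; have [[[k _ Fkx] cx]|xF] := pselect ((\bigcup_i
        F i `&` cube r) x).
        rewrite mem_set; last by split=> //; exists k.
        apply: cvg_near_cst; near=> n; rewrite indicE mem_set//.
        have /ndF/subsetPset FkFn : (k <= n)%N by near: n; exists k.
        by split=> //; exact: FkFn.
      rewrite memNset//; apply: cvg_near_cst; near=> n;
        rewrite indicE memNset//.
      by move=> [Fnx cx]; apply: xF; split=> //; exists n.
    * exact: integrable_indic_cube.
    * move=> n x; rewrite !indicE !in_setI; case: (x \in cube r); last first.
        by rewrite !andbF subrr expr0n.
      by rewrite !andbT; do 2 case: (_ \in _);
        rewrite /= ?subrr ?subr0 ?sub0r ?sqrrN ?expr1n ?expr0n.
- move=> _ [a _ [b _ <-]]; split; first exact: measurable_box.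
  have [c _ [d _ <-]] : boxes (box a b `&` cube r).
    by apply: setI_closed_boxes; do 2 eexists.
  exact: approximable_box.
Unshelve. all: by end_near. Qed.

Import HBNNSimple.

(** Simple functions increasing to [f], cut off to growing cubes, stay between 0 and [f], so the
    squared error is dominated by the integrable [f x ^+ 2]. Each of them is a finite combination of
    indicators of bounded measurable sets. *)
Lemma approximable_Lfun2 f : (forall x, 0 <= f x) -> f \in Lfun mu 2%:E ->
  approximable f.
Proof.
move=> f0 f2; have [mf _] := (Lfun2P mu f).1 f2.
have mfE : measurable_fun setT (EFin \o f) by exact/measurable_EFinP.
pose s n : 'rV[R]_N -> R := nnsfun_approx measurableT mfE n.
have s0 n x : 0 <= s n x by exact: fun_ge0.
have ms n : measurable_fun setT (s n) by exact: measurable_funPT.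
have s_f x : s ^~ x @ \oo --> f x.
  have /fine_cvg : EFin \o s ^~ x @ \oo --> (EFin \o f) x.
    by apply: cvg_nnsfun_approx => // y _; rewrite lee_fin.
  exact.
have sf n x : s n x <= f x.
  rewrite -(cvg_lim (@Rhausdorff R) (s_f x)).
  apply: nondecreasing_cvgn_le; last by apply/cvg_ex; exists (f x).
  by move=> i j ij; have /lefP := nd_nnsfun_approx measurableT mfE ij; exact.
pose c n : set 'rV[R]_N := cube n.+1%:R.
apply: (@approximable_dominated _ _ (fun n x => s n x * \1_(c n) x) _
  (fun x => f x ^+ 2)).
- move=> n; have -> : (fun x => s n x * \1_(c n) x) = (fun x =>
      \sum_(y <- finmap.enum_fset (fset_set (range (s n)))) y *
      \1_(s n @^-1` [set y] `&` c n) x).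
    apply/funext => x; rewrite {1}/s fimfunE fsbig_finite//= mulr_suml.
    by apply: eq_bigr => i _; rewrite indicI mulrA.
  apply: approximable_sum => i; apply: approximable_scale.
  by apply: approximable_indic_cube; rewrite -[X in measurable X]setTI;
    exact: ms.
- exact: mf.
- move=> x; rewrite -[X in _ --> X]mulr1; apply: cvgM; first exact: s_f.
  apply: cvg_near_cst; near=> n; rewrite indicE mem_set//.
  apply/cubeP => //; apply: (lt_le_trans (truncnS_gt _)).
  by rewrite ler_nat ltnS; near: n; exists (Num.truncn `|x|).
- exact: Lfun2_integrable_sqr.
- move=> n x; rewrite ler_sqr ?nnegrE//.
    by rewrite lerBlDr lerDl mulr_ge0.
  by rewrite subr_ge0 (le_trans _ (sf n x))// ler_piMr// indicE;
    case: (_ \in _).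
Unshelve. all: by end_near. Qed.

End density.

(** * Energies with a general nonnegative measurable kernel *)

Section kernel_energy.
Context {R : realType} {N : nat}.
Local Notation mu := (lebesgue_row R N).
Variable k : 'rV[R]_N -> R.
Hypothesis k0 : forall x, 0 <= k x.
Hypothesis mk : measurable_fun setT k.
Implicit Types (w : 'rV[R]_N -> R) (x y : 'rV[R]_N).

Definition energy w : \bar R :=
  (\int[mu]_x (convolution k w x * (w x)%:E))%E.

Definition energy_density w (z : 'rV[R]_N * 'rV[R]_N) : R :=
  k (z.1 - z.2) * w z.2 * w z.1.

Lemma measurable_energy_kernel w : measurable_fun setT w ->
  measurable_fun setT (fun z : 'rV[R]_N * 'rV[R]_N => k (z.1 - z.2) * w z.2).
Proof.
move=> mw; apply: measurable_funM.
  apply: (measurableT_comp mk).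
  apply: measurable_fun_row => i; under eq_fun do rewrite !mxE.
  by apply: measurable_funB; apply: (measurableT_comp (measurable_coord i)).
exact: measurableT_comp.
Qed.

Lemma measurable_convolution_integrand w x : measurable_fun setT w ->
  measurable_fun setT (fun y => (k (x - y) * w y)%:E).
Proof.
move=> mw; apply/measurable_EFinP.
exact: (measurableT_comp (measurable_energy_kernel mw) (pair1_measurable x)).
Qed.

Lemma measurable_energy_density w : measurable_fun setT w ->
  measurable_fun setT (energy_density w).
Proof.
move=> mw; apply: measurable_funM; first exact: measurable_energy_kernel.
exact: measurableT_comp.
Qed.

Lemma energy_density_ge0 w z : (forall x, 0 <= w x) -> 0 <= energy_density w z.
Proof. by move=> w0; rewrite !mulr_ge0. Qed.

Lemma measurable_convolution w : measurable_fun setT w -> (forall x,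
  0 <= w x) ->
  measurable_fun setT (convolution k w).
Proof.
move=> mw w0; apply: (measurable_fun_fubini_tonelli_F
  (fun z : 'rV[R]_N * 'rV[R]_N => (k (z.1 - z.2) * w z.2)%:E)).
  by apply/measurable_EFinP; exact: measurable_energy_kernel.
by move=> z; rewrite lee_fin mulr_ge0.
Qed.

Lemma convolution_ge0 w x : (forall x, 0 <= w x) -> (0 <= convolution k w x)%E.
Proof.
by move=> w0; apply: integral_ge0 => y _; rewrite lee_fin mulr_ge0.
Qed.

(** Tonelli's theorem. As a single integral of a nonnegative density over the product space, the
    energy inherits monotonicity and Fatou's lemma directly. *)
Lemma energyE w : measurable_fun setT w -> (forall x, 0 <= w x) ->
  energy w = (\int[mu \x mu]_z (energy_density w z)%:E)%E.
Proof.
move=> mw w0.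
rewrite (@fubini_tonelli1 _ _ _ _ _ mu mu); last 2 first.
- by apply/measurable_EFinP; exact: measurable_energy_density.
- by move=> z; rewrite lee_fin energy_density_ge0.
apply: eq_integral => x _; rewrite /fubini_F /energy_density /=.
under [RHS]eq_integral do rewrite EFinM.
rewrite ge0_integralZr//.
- exact: measurable_convolution_integrand.
- by move=> y _; rewrite lee_fin mulr_ge0.
- by rewrite lee_fin.
Qed.

Lemma le_energy w1 w2 : measurable_fun setT w1 -> measurable_fun setT w2 ->
  (forall x, 0 <= w1 x <= w2 x) -> (energy w1 <= energy w2)%E.
Proof.
move=> m1 m2 w12.
have w10 x : 0 <= w1 x by have /andP[] := w12 x.
have w2_ge x : w1 x <= w2 x by have /andP[] := w12 x.
have w20 x : 0 <= w2 x by exact: le_trans (w2_ge x).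
rewrite !energyE//; apply: ge0_le_integral => //.
- by move=> z _; rewrite lee_fin energy_density_ge0.
- by apply/measurable_EFinP; exact: measurable_energy_density.
- by apply/measurable_EFinP; exact: measurable_energy_density.
- move=> z _; rewrite lee_fin ler_pM// ?mulr_ge0 //.
  by rewrite ler_wpM2l.
Qed.

(** Convergence is assumed at every point, so the densities converge at every point of the product;
    an exceptional null set is removed beforehand in [riesz_energy_liminf]. *)
Lemma energy_fatou (w_ : nat -> 'rV[R]_N -> R) w (c : \bar R) :
  (forall n, measurable_fun setT (w_ n)) -> (forall n x, 0 <= w_ n x) ->
  measurable_fun setT w -> (forall x, w_ ^~ x @ \oo --> w x) ->
  (forall n, energy (w_ n) <= c)%E -> (energy w <= c)%E.
Proof.
move=> mw_ w_0 mw w_w Ec.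
have w0 x : 0 <= w x.
  rewrite -(cvg_lim (@Rhausdorff R) (w_w x)).
  by apply: limr_ge; [apply/cvg_ex; exists (w x)|near=> n].
rewrite energyE//.
under eq_integral => z _.
  rewrite (_ : (_ z)%:E = limn_einf (fun n => (energy_density (w_ n) z)%:E));
    last first.
    apply/esym; have [] // := @cvg_limn_einf_sup _ (fun n =>
      (energy_density (w_ n) z)%:E)
      (energy_density w z)%:E.
    apply: cvg_EFin; first by near=> n.
    rewrite /comp /energy_density /=.
    apply: cvgM; last exact: w_w.
    by apply: cvgM; [exact: cvg_cst|exact: w_w].
  over.
apply: (@le_trans _ _ (limn_einf (fun n => \int[mu \x mu]_z (energy_density (w_
  n) z)%:E))%E).
  apply: fatou => //.
  - by move=> n; by apply/measurable_EFinP; exact: measurable_energy_density.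
  - by move=> n z _; rewrite lee_fin energy_density_ge0.
(* The infimum over the tail from [n] on is at most its first term, the energy of [w_ n]. *)
rewrite limn_einf_lim; apply: lime_le; first exact: is_cvg_einfs.
near=> n; apply: (@le_trans _ _ (energy (w_ n))) => //.
rewrite [leRHS]energyE//; apply: ereal_inf_lbound; exists n => //=.
Unshelve. all: by end_near. Qed.

(** A null set in the inner variable changes the convolution at no point; a null set in the outer
    variable then leaves the outer integral unchanged. *)
Lemma energy_ae_eq w1 w2 : measurable_fun setT w1 -> measurable_fun setT w2 ->
  (forall x, 0 <= w1 x) -> (forall x, 0 <= w2 x) ->
  {ae mu, forall x, w1 x = w2 x} -> energy w1 = energy w2.
Proof.
move=> m1 m2 w10 w20 w12.
have conv x : convolution k w1 x = convolution k w2 x.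
  apply: ae_eq_integral => //.
  - exact: measurable_convolution_integrand.
  - exact: measurable_convolution_integrand.
  - by apply: filterS w12 => y /= -> _.
apply: ae_eq_integral => //.
- apply: emeasurable_funM; first exact: measurable_convolution.
  exact/measurable_EFinP.
- apply: emeasurable_funM; first exact: measurable_convolution.
  exact/measurable_EFinP.
- by apply: filterS w12 => x /= -> _; rewrite conv.
Qed.

End kernel_energy.

(** * Homogeneity and local integrability of the Riesz kernel *)

Section riesz_kernel.
Context {R : realType} {N : nat}.
Local Notation mu := (lebesgue_row R N).
Variable alpha : R.
Hypothesis alpha_range : 0 < alpha < N%:R.
Implicit Types x y : 'rV[R]_N.

Let k : 'rV[R]_N -> R := riesz_potential alpha.

Lemma gamma_fun_ge0 (s : R) : 0 <= gamma_fun s.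
Proof. by apply: Rintegral_ge0 => t _; rewrite mulr_ge0// ?powR_ge0 ?expR_ge0.
  Qed.

Lemma enorm_ge0 x : 0 <= enorm x.
Proof. exact: sqrtr_ge0. Qed.

(** Relates the Euclidean norm of the kernel to the sup norm, whose balls are the cubes. *)
Lemma norm_le_enorm x : `|x| <= enorm x.
Proof.
have [x0|x0] := eqVneq `|x| 0; first by rewrite x0 enorm_ge0.
have /mx_norm_neq0[[i j] /= xij] := x0.
rewrite [leLHS]xij ord1 -sqrtr_sqr ler_wsqrtr//.
rewrite (bigD1 j)//= lerDl sumr_ge0// => l _; exact: sqr_ge0.
Qed.

Definition riesz_constant : R := gamma_fun ((N%:R - alpha) / 2) /
  (2 `^ alpha * pi `^ (N%:R / 2) * gamma_fun (alpha / 2)).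

Lemma riesz_constant_ge0 : 0 <= riesz_constant.
Proof. by rewrite divr_ge0 ?mulr_ge0 ?gamma_fun_ge0 ?powR_ge0. Qed.

Lemma riesz_potentialE x :
  k x = riesz_constant * enorm x `^ (alpha - N%:R).
Proof.
by rewrite /k /riesz_potential invfM mulrA -[alpha - _]opprB powRN.
Qed.

Lemma riesz_potential_ge0 x : 0 <= k x.
Proof. by rewrite riesz_potentialE mulr_ge0 ?riesz_constant_ge0 ?powR_ge0. Qed.

Lemma measurable_enorm : measurable_fun setT (@enorm R N).
Proof.
apply: measurableT_comp => //.
  apply: continuous_measurable_fun; exact: sqrt_continuous.
under eq_fun do rewrite -(big_enum)/=.
apply: measurable_sum => i; apply: measurable_funX; exact: measurable_coord.
Qed.

Lemma measurable_riesz_potential : measurable_fun setT k.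
Proof.
rewrite (_ : k = fun x => riesz_constant * enorm x `^ (alpha - N%:R));
  last first.
  by apply/funext => x; rewrite riesz_potentialE.
apply: measurable_funM => //; apply: (measurableT_comp (measurable_powR _)).
exact: measurable_enorm.
Qed.

Lemma enormZ (l : R) x : 0 < l -> enorm (l *: x) = l * enorm x.
Proof.
move=> l0; rewrite /enorm.
transitivity (Num.sqrt (l ^+ 2 * \sum_i x ord0 i ^+ 2)); last first.
  by rewrite sqrtrM ?sqr_ge0// sqrtr_sqr gtr0_norm.
by rewrite mulr_sumr; congr Num.sqrt; apply: eq_bigr => i _; rewrite mxE exprMn.
Qed.

Lemma riesz_potentialZ (l : R) x : 0 < l ->
  k (l *: x) = l `^ (alpha - N%:R) * k x.
Proof.
move=> l0; rewrite !riesz_potentialE enormZ// powRM ?enorm_ge0 ?ltW//.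
by rewrite mulrCA.
Qed.

Lemma geometric_eseries_lty (B q : R) : 0 <= q < 1 ->
  (\sum_(j <oo) (B * q ^+ j)%:E < +oo)%E.
Proof.
move=> /andP[q0 q1].
have /cvgP c : series (geometric B q) @ \oo --> B * (1 - q)^-1.
  by apply: cvg_geometric_series; rewrite ger0_norm.
rewrite (_ : (\sum_(j <oo) _)%E = (limn (series (geometric B q)))%:E) ?ltry//.
rewrite -EFin_lim//; apply: congr_lim; apply/funext => n /=.
by rewrite sumEFin.
Qed.

(* On the dyadic shell [t/2 <= |x| < t], with [t = rho / 2^j], the potential is
   at most a constant times [t `^ (alpha - N)]. *)
Definition shell_bound (rho : R) (j : nat) x : R :=
  riesz_constant * (rho / 2 ^+ j / 2) `^ (alpha - N%:R) *
    \1_(cube (rho / 2 ^+ j)) x.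

Lemma shell_bound_ge0 rho j x : 0 <= shell_bound rho j x.
Proof.
by apply: mulr_ge0 => //; apply: mulr_ge0;
  [exact: riesz_constant_ge0|exact: powR_ge0].
Qed.

(** A nonzero point lies in some dyadic shell, and the term of that shell alone dominates the
    kernel, because the exponent [alpha - N%:R] is negative. *)
Lemma riesz_potential_le_series (rho : R) x : 0 < rho -> `|x| < rho ->
  ((k x)%:E <= \sum_(j <oo) (shell_bound rho j x)%:E)%E.
Proof.
move=> rho0 xrho.
have rK := riesz_constant_ge0.
have term0 j : (0 <= (shell_bound rho j x)%:E)%E.
  by rewrite lee_fin shell_bound_ge0.
(* At the origin the kernel takes the default value 0, as the exponent is nonzero. *)
have [x0|x0] := eqVneq x 0.
  rewrite riesz_potentialE x0 (_ : enorm 0 = 0).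
    rewrite powR0 ?mulr0; first by apply: nneseries_ge0 => j _ _;
      rewrite -x0 term0.
    by rewrite subr_eq0; case/andP: alpha_range => _ /lt_eqF ->.
  rewrite /enorm big1 ?sqrtr0// => i _; by rewrite mxE expr0n.
have xn0 : 0 < `|x| by rewrite normr_gt0.
have ex : exists j, rho / 2 ^+ j / 2 <= `|x|.
  pose j := (Num.truncn (rho / `|x|)).+1; exists j.
  have : rho / `|x| < 2 ^+ j.
    have : (j < 2 ^ j)%N by exact: ltn_expl.
    rewrite -(ltr_nat R) natrX => /ltW; apply: lt_le_trans.
    exact: truncnS_gt.
  rewrite ltr_pdivrMr// => rx; rewrite ler_pdivrMr// ler_pdivrMr ?exprn_gt0//.
  by rewrite mulrAC mulrC; lra.
(* Minimality of [j] yields the outer bound of the shell; for [j = 0] that bound is the hypothesis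
   on [x]. *)
case: (ex_minnP ex) => j jx jmin.
have xj : `|x| < rho / 2 ^+ j.
  case: j jx jmin => [|j] jx jmin; first by rewrite expr0 divr1.
  rewrite ltNge; apply/negP => jx'; suff /jmin : rho / 2 ^+ j / 2 <= `|x|.
    by rewrite ltnn.
  by rewrite -mulrA -invfM -exprSr.
apply: (@le_trans _ _ (shell_bound rho j x)%:E).
  rewrite /shell_bound indicE mem_set ?mulr1; last first.
    by apply/cubeP => //; rewrite divr_gt0// exprn_gt0.
  rewrite lee_fin riesz_potentialE ler_wpM2l//.
  have t0 : 0 < rho / 2 ^+ j / 2 by rewrite !divr_gt0// exprn_gt0.
  have xe : 0 < enorm x by exact: lt_le_trans (norm_le_enorm x).
  have aN : 0 <= N%:R - alpha by rewrite subr_ge0 ltW//; case/andP: alpha_range.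
  rewrite -[alpha - _]opprB !powRN lef_pV2 ?posrE ?powR_gt0//.
  have tx : rho / 2 ^+ j / 2 <= enorm x := le_trans jx (norm_le_enorm x).
  by rewrite ge0_ler_powR ?nnegrE ?(ltW t0) ?(ltW xe).
rewrite (nneseriesD1 (n := j) (P := xpredT))//.
by rewrite leeDl//; apply: nneseries_ge0 => i _ _; exact: term0.
Qed.

Lemma measurable_shell_bound rho j : measurable_fun setT (shell_bound rho j).
Proof.
by apply: measurable_funM => //; apply: measurable_indic; exact: measurable_box.
Qed.

(** With t = rho / 2^j, the cube has volume (2t)^N and t^(alpha - N) t^N = t^alpha. The integrals
    are thus geometric in [j], with ratio 2^(-alpha). *)
Lemma integral_shell_bound rho j x : 0 < rho ->
  (\int[mu]_y (shell_bound rho j (x - y))%:E =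
   (riesz_constant * 2 `^ (N%:R - alpha) * 2 ^+ N * rho `^ alpha *
     (2 `^ (- alpha)) ^+ j)%:E)%E.
Proof.
move=> rho0; set t := rho / 2 ^+ j.
have t0 : 0 < t by rewrite divr_gt0// exprn_gt0.
pose c := riesz_constant * (t / 2) `^ (alpha - N%:R).
have c0 : 0 <= c by rewrite mulr_ge0 ?powR_ge0 ?riesz_constant_ge0.
transitivity (\int[mu]_y (c%:E * (\1_(box (x - const_mx t) (x + const_mx t))
  y)%:E))%E.
  apply: eq_integral => y _; rewrite -EFinM /shell_bound -/t -/c;
    congr (_ * _)%:E.
  rewrite !indicE; congr (nat_of_bool _)%:R; apply/idP/idP; rewrite !inE => h i;
    have := h i; rewrite !mxE !in_itv/= => /andP[? ?]; apply/andP; split; lra.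
rewrite ge0_integralZl_EFin//; last first.
  by apply/measurable_EFinP; apply: measurable_indic; exact: measurable_box.
rewrite integral_indic//; last exact: measurable_box.
rewrite setIT [X in (_ * X)%E](lebesgue_row_boxE _ _) -EFinM; congr EFin.
under eq_bigr do rewrite !mxE opprB [t - _]addrC addrACA subrr add0r.
rewrite prodr_const card_ord max_r; last by rewrite addr_ge0// ltW.
have -> : (t + t) ^+ N = 2 ^+ N * t ^+ N by rewrite -exprMn mulr_natl.
rewrite /c.
have -> : (t / 2) `^ (alpha - N%:R) = t `^ (alpha - N%:R) * 2 `^ (N%:R - alpha).
  rewrite powRM ?ltW// ?invr_ge0//; congr (_ * _).
  by rewrite -[in LHS](powR_inv1 (ler0n _ 2)) -powRrM mulN1r opprB.
have tN : t `^ (alpha - N%:R) * t ^+ N = t `^ alpha.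
  by rewrite -powR_mulrn ?ltW// -powRD ?subrK// (gt_eqF t0) implybT.
rewrite -[RHS]mulrA; have -> : rho `^ alpha * (2 `^ (- alpha)) ^+ j = t `^
  alpha.
  rewrite /t powRM ?ltW// ?invr_ge0 ?exprn_ge0//; congr (_ * _).
  rewrite -powR_mulrn ?powR_ge0// -powRrM -(powR_invn _ (ler0n _ 2)) -powRrM.
  by congr (_ `^ _); ring.
rewrite -tN; ring.
Qed.

(** Local integrability, uniform in the centre [x]: the integrals over the shells do not depend on
    [x] and form a convergent geometric series since alpha > 0. *)
Lemma riesz_potential_integral_bounded (rho : R) : 0 < rho ->
  exists2 M : R, 0 <= M & forall x,
    (\int[mu]_y (k (x - y)%R * \1_(cube rho) (x - y)%R)%:E <= M%:E)%E.
Proof.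
move=> rho0; have /andP[a0 aN] := alpha_range.
pose S x := (\int[mu]_y (\sum_(j <oo) (shell_bound rho j (x - y))%:E))%E.
pose B := riesz_constant * 2 `^ (N%:R - alpha) * 2 ^+ N * rho `^ alpha.
have B0 : 0 <= B.
  rewrite /B; move: riesz_constant riesz_constant_ge0 => K K0.
  by rewrite !mulr_ge0 ?powR_ge0 ?exprn_ge0.
pose q : R := 2 `^ (- alpha).
have q01 : 0 <= q < 1.
  rewrite powR_ge0/= /q powRN invf_lt1 ?powR_gt0//.
  have p1 : 1 `^ alpha = 1 :> R by rewrite powR1.
  by rewrite -[ltLHS]p1 gt0_ltr_powR ?nnegrE ?ltr1n.
have SE x : S x = (\sum_(j <oo) (B * q ^+ j)%:E)%E.
  rewrite /S integral_nneseries//.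
  - by apply: eq_eseriesr => j _; rewrite integral_shell_bound.
  - move=> j; apply/measurable_EFinP.
    exact: (measurableT_comp (measurable_shell_bound rho j) (measurable_subl
      x)).
  - by move=> j y _; rewrite lee_fin shell_bound_ge0.
have Bq := geometric_eseries_lty B q01.
exists (fine (\sum_(j <oo) (B * q ^+ j)%:E)%E).
  rewrite fine_ge0//; apply: nneseries_ge0 => j _ _.
  by rewrite lee_fin mulr_ge0// exprn_ge0//; case/andP: q01.
move=> x; rewrite fineK; last first.
  rewrite ge0_fin_numE//; apply: nneseries_ge0 => j _ _.
  by rewrite lee_fin mulr_ge0// exprn_ge0//; case/andP: q01.
rewrite -(SE x); apply: ge0_le_integral => //.
- by move=> y _; rewrite lee_fin mulr_ge0// riesz_potential_ge0.
- apply/measurable_EFinP; apply: measurable_funM.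
    exact: (measurableT_comp measurable_riesz_potential (measurable_subl x)).
  apply: (measurableT_comp _ (measurable_subl x)).
  by apply: measurable_indic; exact: measurable_box.
- apply: ge0_emeasurable_sum => j; first by move=> y _ _;
    rewrite lee_fin shell_bound_ge0.
  move=> _; apply/measurable_EFinP.
  exact: (measurableT_comp (measurable_shell_bound rho j) (measurable_subl x)).
- move=> y _; rewrite indicE; case: (boolP (_ \in _)) => [|_].
    by rewrite inE mulr1 => /(cubeP _ rho0); exact: riesz_potential_le_series.
  by rewrite mulr0; apply: nneseries_ge0 => j _ _;
    rewrite lee_fin shell_bound_ge0.
Qed.

End riesz_kernel.

(** * Finiteness and scaling of the Riesz energy *)

Section riesz_energy.
Context {R : realType} {N : nat}.
Local Notation mu := (lebesgue_row R N).
Variable alpha : R.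
Hypothesis alpha_range : 0 < alpha < N%:R.
Implicit Types (w : 'rV[R]_N -> R) (x y : 'rV[R]_N).

Local Notation k := (riesz_potential (N := N) alpha).

Let k0 := @riesz_potential_ge0 R N alpha.
Let mk := @measurable_riesz_potential R N alpha.

(** Two points of norm less than [r] differ by a vector of norm less than [2 * r], so the
    convolution sees only the truncated kernel there and is at most [C * M]; it remains to integrate
    [w]. *)
Lemma energy_lty w (C : R) : measurable_fun setT w ->
  (forall x, 0 <= w x <= C) -> supported w -> (energy k w < +oo)%E.
Proof.
move=> mw wC /supported_pos[r r0 wr].
have w0 x : 0 <= w x by have /andP[] := wC x.
have C0 : 0 <= C by have /andP[] := wC 0; exact: le_trans.
have r2 : 0 < 2 * r by rewrite mulr_gt0.
have [M M0 kM] := riesz_potential_integral_bounded alpha_range r2.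
have mkx x : measurable_fun setT
    (fun y : 'rV[R]_N => (k (x - y) * \1_(cube (2 * r)) (x - y))%:E).
  apply/measurable_EFinP; apply: (measurableT_comp (f := fun z => k z * _ z)
    _ (measurable_subl x)).
  by apply: measurable_funM => //; apply: measurable_indic;
    exact: measurable_box.
have conv x : `|x| < r -> (convolution k w x <= (C * M)%:E)%E.
  move=> xr; apply: (@le_trans _ _ (\int[mu]_y (C%:E *
      (k (x - y)%R * \1_(cube (2 * r)) (x - y)%R)%:E))%E).
    apply: ge0_le_integral => //.
    - by move=> y _; rewrite lee_fin mulr_ge0.
    - exact: measurable_convolution_integrand.
    - exact: measurable_funeM.
    - move=> y _; rewrite -EFinM lee_fin mulrCA; have [yr|ry] := ltP `|y| r.
        rewrite ler_wpM2l// indicE mem_set ?mulr1; last first.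
          apply/cubeP => //; apply: (le_lt_trans (ler_normB _ _)).
          by rewrite mulr_natl mulr2n ltrD.
        by have /andP[] := wC y.
      by rewrite wr// mulr0; apply: mulr_ge0 => //; exact: mulr_ge0.
  rewrite ge0_integralZl_EFin//; last by move=> y _; rewrite lee_fin mulr_ge0.
  by rewrite EFinM; apply: lee_wpmul2l.
have iw : mu.-integrable setT (EFin \o w).
  by apply: (supported_integrable mw (C := C)) => [|x];
    [exists r|rewrite ger0_norm//; have /andP[] := wC x].
apply: (@le_lt_trans _ _ (\int[mu]_x ((C * M)%:E * (w x)%:E))%E).
  apply: ge0_le_integral => //.
  - by move=> x _; rewrite mule_ge0// ?convolution_ge0 ?lee_fin.
  - by apply: emeasurable_funM; [exact:
      measurable_convolution|exact/measurable_EFinP].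
  - by apply: measurable_funeM; exact/measurable_EFinP.
  - move=> x _; have [xr|rx] := ltP `|x| r; last by rewrite wr// !mule0.
    by apply: lee_wpmul2r; rewrite ?lee_fin// conv.
rewrite ge0_integralZl_EFin ?mulr_ge0//; first last.
- exact/measurable_EFinP.
- by move=> x _; rewrite lee_fin.
rewrite lte_mul_pinfty ?lee_fin ?mulr_ge0//.
have /integrableP[_] := iw; congr (_ < _)%E.
by apply: eq_integral => x _; rewrite /= ger0_norm.
Qed.

(** The two changes of variables contribute l^(-2N), and the homogeneity of the kernel l^(N -
    alpha). *)
Lemma energy_scale w (c l : R) : 0 <= c -> 0 < l -> measurable_fun setT w ->
  (forall x, 0 <= w x) ->
  (energy k (fun x => c * w (l *: x))%R =
    (c ^+ 2 * (l `^ (alpha + N%:R))^-1)%:E * energy k w)%E.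
Proof.
move=> c0 l0 mw w0.
have lN0 : l ^+ N != 0 by rewrite expf_eq0 (gt_eqF l0) andbF.
have conv x : convolution k (fun x => c * w (l *: x)) x =
    ((c * l `^ (- alpha))%:E * convolution k w (l *: x)%R)%E.
  rewrite /convolution [in RHS](ge0_integral_affine 0 l0); first last.
  - by move=> y; rewrite lee_fin mulr_ge0.
  - exact: measurable_convolution_integrand.
  rewrite muleA -EFinM -ge0_integralZl_EFin//; first last.
  - by rewrite !mulr_ge0 ?powR_ge0 ?exprn_ge0// ltW.
  - have := measurable_convolution_integrand mk (l *: x) mw.
    by move/measurableT_comp; apply; exact: measurable_affine.
  - by move=> y _; rewrite lee_fin mulr_ge0.
  apply: eq_integral => y _; rewrite -EFinM; congr EFin.
  rewrite addr0 -scalerBr riesz_potentialZ//.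
  have : l `^ (- alpha) * l ^+ N * l `^ (alpha - N%:R) = 1.
    rewrite -powR_mulrn ?ltW// -powRD ?(gt_eqF l0) ?implybT//.
    rewrite -powRD ?(gt_eqF l0) ?implybT//.
    have -> : - alpha + N%:R + (alpha - N%:R) = 0 by ring.
    exact: powRr0.
  move=> lE; rewrite -[LHS]mul1r -[X in X * _ = _]lE; ring.
have mcw : measurable_fun setT (fun x => (convolution k w x * (w x)%:E)%E).
  by apply: emeasurable_funM; [exact:
    measurable_convolution|exact/measurable_EFinP].
have cw0 x : (0 <= convolution k w x * (w x)%:E)%E.
  by rewrite mule_ge0// ?convolution_ge0 ?lee_fin.
rewrite /energy; under eq_integral do rewrite conv.
rewrite [in RHS](ge0_integral_affine 0 l0)//.
rewrite muleA -EFinM -ge0_integralZl_EFin//; first last.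
- by rewrite !mulr_ge0 ?invr_ge0 ?powR_ge0 ?exprn_ge0// ltW.
- by apply: (measurableT_comp mcw); exact: measurable_affine.
apply: eq_integral => x _; rewrite addr0.
have -> : c ^+ 2 * (l `^ (alpha + N%:R))^-1 * l ^+ N = c * l `^ (- alpha) * c.
  rewrite powRN powRD ?(gt_eqF l0) ?implybT// powR_mulrn ?ltW// invfM.
  by field; rewrite lN0 gt_eqF ?powR_gt0.
rewrite (EFinM c (w _)) (EFinM (_ * _) c) -!muleA; congr (_ * _)%E.
by rewrite muleCA.
Qed.

End riesz_energy.

(** * Pointwise convergence: powers, and sequences with summable L^2 errors *)

Lemma cvg_powR {R : realType} (u : R^nat) (l p : R) : 0 < p ->
  (forall n, 0 <= u n) -> u @ \oo --> l -> (fun n => u n `^ p) @ \oo --> l `^ p.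
Proof.
move=> p0 u0 ul.
have l0 : 0 <= l.
  rewrite -(cvg_lim (@Rhausdorff R) ul).
  by apply: limr_ge; [apply/cvg_ex; exists l|near=> n].
(* Derivability of the power gives continuity at a positive limit; a zero limit is treated directly,
   with threshold e^(1/p). *)
move: l0; rewrite le_eqVlt => /predU1P[l0|l0]; last first.
  have c : {for l, continuous (@powR R ^~ p)}.
    apply/differentiable_continuous/derivable1_diffP/derivable_powR.
    by rewrite in_itv/= andbT.
  exact: (cvg_comp _ _ ul c).
rewrite -l0 powR0 ?gt_eqF//; apply/cvgr0Pnorm_le => e e0; near=> n.
rewrite ger0_norm ?powR_ge0//.
have -> : e = (e `^ p^-1) `^ p by rewrite -powRrM mulVf ?gt_eqF// powRr1// ltW.
rewrite ge0_ler_powR ?nnegrE ?powR_ge0 ?(ltW p0)//.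
rewrite -[u n]ger0_norm//; near: n.
by apply: (cvgr0_norm_le _) => //; [rewrite l0|rewrite powR_gt0].
Unshelve. all: by end_near. Qed.

(** The integrals of the squared errors have a finite sum, so the series of squared errors is
    integrable, hence finite almost everywhere, and its terms tend to 0 there. *)
Lemma sqint_summable_ae d (T : measurableType d) {R : realType}
    (mu : {measure set T -> \bar R}) (f : T -> R) (v : nat -> T -> R) (e : R) :
  0 < e -> measurable_fun setT f -> (forall n, measurable_fun setT (v n)) ->
  (forall n, (sqint mu (f \- v n)%R <= (e / (2 ^ n.+1)%:R)%:E)%E) ->
  {ae mu, forall x, v ^~ x @ \oo --> f x}.
Proof.
move=> e0 mf mv fv.
pose t n x : \bar R := ((f x - v n x) ^+ 2)%:E.
have t0 n x : (0 <= t n x)%E by rewrite lee_fin sqr_ge0.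
have mt n : measurable_fun setT (t n).
  by apply: measurable_EFin_sqr; exact: measurable_funB.
have mS : measurable_fun setT (fun x => (\sum_(n <oo) t n x)%E).
  by apply: ge0_emeasurable_sum => // n; move=> x _ _.
have iS : mu.-integrable setT (fun x => (\sum_(n <oo) t n x)%E).
  apply/integrableP; split=> //.
  under eq_integral do rewrite gee0_abs ?nneseries_ge0//.
  rewrite integral_nneseries//.
  apply: le_lt_trans (ltry e); apply: le_trans (epsilon_trick0 xpredT (ltW e0)).
  by apply: lee_nneseries => [n _ _|n _]; [exact: integral_ge0|exact: fv].
have := integrable_ae measurableT iS; apply: filterS => x /(_ I) Sx.
have Sxoo : (\sum_(n <oo) t n x < +oo)%E.
  by rewrite -ge0_fin_numE// nneseries_ge0.
have tail := nneseries_tail_cvg Sxoo (fun n _ => t0 n x).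
have t_0 : (fun n => t n x) @ \oo --> 0%E.
  apply: (squeeze_cvge _ (cvg_cst _) tail); near=> n; rewrite t0/=.
  rewrite (nneseries_split n 1)//= ?addn1 ?big_nat1//.
  by rewrite leeDl// nneseries_ge0.
have /fine_cvg := t_0; rewrite /comp/= => t_0'.
apply/cvgrPdist_le => d0 d00; near=> n.
have : (f x - v n x) ^+ 2 <= d0 ^+ 2.
  rewrite -[leLHS]ger0_norm ?sqr_ge0//; near: n.
  by apply: (cvgr0_norm_le _ t_0'); rewrite exprn_gt0.
by rewrite -[X in X <= _]real_normK ?num_real// ler_sqr ?nnegrE// ltW.
Unshelve. all: by end_near. Qed.

(** * Almost optimal C^1 competitors *)

Section minimization.
Context {R : realType} {N : nat}.
Local Notation mu := (lebesgue_row R N).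
Variable alpha : R.
Hypothesis alpha_range : 0 < alpha < N%:R.
Implicit Types (u v w : 'rV[R]_N -> R) (G : 'rV[R]_N -> 'rV[R]_N).

Local Notation k := (riesz_potential (N := N) alpha).
Local Notation p := (alpha / N%:R + 1).

Let k0 := @riesz_potential_ge0 R N alpha.
Let mk := @measurable_riesz_potential R N alpha.

Lemma dimension_gt0 : 0 < N%:R :> R.
Proof. by case/andP: alpha_range => a0; exact: lt_trans. Qed.

Lemma exponent_ge1 : 1 <= p.
Proof.
case/andP: alpha_range => a0 _; rewrite lerDr divr_ge0//; exact: ltW.
Qed.

Lemma exponent_gt0 : 0 < p.
Proof. exact: lt_le_trans exponent_ge1. Qed.

Lemma measurable_powR_norm u : measurable_fun setT u ->
  measurable_fun setT (fun x => `|u x| `^ p).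
Proof.
move=> mu'; apply: (measurableT_comp (measurable_powR _)).
exact: measurableT_comp.
Qed.

Lemma riesz_energy_liminf u (v : nat -> 'rV[R]_N -> R) (c : \bar R) :
  measurable_fun setT u -> (forall n, measurable_fun setT (v n)) ->
  {ae mu, forall x, (fun n => `|v n x|) @ \oo --> `|u x|} ->
  (forall n, riesz_energy alpha (v n) <= c)%E -> (riesz_energy alpha u <= c)%E.
Proof.
move=> mu' mv [Z [mZ Z0 vuZ]] vc.
have p0 := exponent_gt0.
(* Multiplication by the indicator of [A] makes the convergence hold everywhere, preserves the
   energy of [u], and can only lower the energies of the [v n]. *)
pose A := ~` Z; have mA : measurable A by exact: measurableC.
pose w n x := `|v n x| `^ p * \1_A x.
have indic01 x : 0 <= (\1_A x : R) <= 1 by rewrite indicE ler0n lern1 leq_b1.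
have mw (z : 'rV[R]_N -> R) : measurable_fun setT z ->
    measurable_fun setT (fun x => `|z x| `^ p * \1_A x : R).
  by move=> mz; apply: measurable_funM; [exact: measurable_powR_norm|exact:
    measurable_indic].
have -> : riesz_energy alpha u = energy k (fun x => `|u x| `^ p * \1_A x).
  apply: (energy_ae_eq k0 mk).
  - exact: measurable_powR_norm.
  - exact: mw.
  - by move=> x; exact: powR_ge0.
  - by move=> x; rewrite mulr_ge0 ?powR_ge0.
  - exists Z; split=> // x /=; apply: contra_notP => xZ.
    by rewrite indicE mem_set// mulr1.
apply: (@energy_fatou _ _ k _ _ w) => //.
- by move=> n; exact: mw.
- by move=> n x; rewrite mulr_ge0 ?powR_ge0.
- exact: mw.
- move=> x; rewrite /w indicE; have [xA|xA] := boolP (x \in A); last first.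
    by under eq_fun do rewrite mulr0; rewrite mulr0; exact: cvg_cst.
  under eq_fun do rewrite mulr1; rewrite mulr1; apply: cvg_powR => //.
  by move: xA; rewrite inE; apply: contra_notP => /vuZ.
- move=> n; apply: le_trans (vc n); apply: le_energy => //;
    [exact: mw|exact: measurable_powR_norm|].
  move=> x; have /andP[i0 i1] := indic01 x.
  by rewrite mulr_ge0 ?powR_ge0//= ler_piMr ?powR_ge0.
Qed.

(** All the approximants [v n] of |u| satisfy the norm bound. If each had energy at most [1 - e],
    then so would [u] by Fatou's lemma, contrary to the assumption. *)
Lemma riesz_energy_approx u (e : R) : u \in Lfun mu 2%:E -> 0 < e ->
  (1 <= riesz_energy alpha u)%E ->
  exists v, [/\ class_C1c v, (sqint mu v <= sqint mu u + e%:E)%E &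
    ((1 - e)%:E < riesz_energy alpha v)%E].
Proof.
move=> u2 e0 u1; have [mu' uoo] := (Lfun2P mu u).1 u2.
have mf : measurable_fun setT (fun x => `|u x|) by exact: measurableT_comp.
have fE : sqint mu (fun x => `|u x|) = sqint mu u.
  by apply: eq_integral => x _; rewrite real_normK ?num_real.
have [||_ fa] := @approximable_Lfun2 _ _ (fun x => `|u x|).
- by [].
- by apply/Lfun2P; rewrite fE.
pose s := fine (sqint mu u).
have sE : sqint mu u = s%:E by rewrite fineK// ge0_fin_numE// sqint_ge0.
have s0 : 0 <= s by rewrite fine_ge0// sqint_ge0.
(* Chosen so that [eta * s <= e / 2] and [(1 + eta^-1) * dlt = e / 2], the two excess terms of
   [sqint_add] with weight [eta]. *)
pose eta := e / (2 * (s + 1)).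
have eta0 : 0 < eta by rewrite divr_gt0// mulr_gt0// ltr_wpDl.
pose dlt := e / (2 * (1 + eta^-1)).
have dlt0 : 0 < dlt by rewrite divr_gt0// mulr_gt0// addr_gt0// invr_gt0.
(* The geometric weights make the errors summable, hence the convergence almost everywhere. *)
have dn n : 0 < dlt / (2 ^ n.+1)%:R by rewrite divr_gt0// ltr0n expn_gt0.
pose v n := sval (cid2 (fa _ (dn n))).
have Cv n : class_C1c (v n) by rewrite /v; case: cid2.
have fv n : (sqint mu ((fun x => `|u x|) \- v n)%R <= (dlt / (2 ^
  n.+1)%:R)%:E)%E.
  by rewrite /v; case: cid2.
have mv n := class_C1c_measurable (Cv n).
have norm_v n : (sqint mu (v n) <= sqint mu u + e%:E)%E.
  have -> : v n = (fun x => `|u x|) \+ (fun x => -1 * ((fun x =>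
    `|u x|) \- v n) x).
    by apply/funext => x /=; rewrite mulN1r opprB addrC subrK.
  have mfv := measurable_funB mf (mv n).
  apply: (le_trans (sqint_add mu eta0 mf _)); first exact: measurable_funM.
  rewrite sqint_scale// sqrrN expr1n mul1e fE sE.
  apply: (@le_trans _ _ ((1 + eta)%:E * s%:E + (1 + eta^-1)%:E * dlt%:E)%E).
    apply: leeD => //; apply: lee_wpmul2l.
      by rewrite lee_fin addr_ge0// invr_ge0 ltW.
    apply: le_trans (fv n) _; rewrite lee_fin ler_pdivrMr ?ltr0n ?expn_gt0//.
    by rewrite ler_peMr ?(ltW dlt0)// ler1n expn_gt0.
  rewrite -!EFinM -!EFinD lee_fin mulrDl mul1r -addrA lerD2l.
  have eta1 : 0 < 1 + eta^-1 by rewrite addr_gt0// invr_gt0.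
  have -> : (1 + eta^-1) * dlt = e / 2.
    rewrite /dlt; move: (1 + eta^-1) eta1 => a a0.
    by field; rewrite gt_eqF.
  suff : eta * s <= e / 2 by lra.
  rewrite /eta invfM mulrA -mulrA ler_piMr ?divr_ge0 ?(ltW e0)//.
  by rewrite mulrC ler_pdivrMr ?mul1r ?lerDl// ltr_wpDl.
apply: contrapT => noex.
have : (riesz_energy alpha u <= (1 - e)%:E)%E.
  apply: (@riesz_energy_liminf u v) => //.
    have := sqint_summable_ae dlt0 mf mv fv; apply: filterS => x vx.
    by rewrite -[`|u x|]normr_id; apply: cvg_norm.
  move=> n; rewrite leNgt; apply/negP => nv; apply: noex.
  by exists (v n); split.
by move=> /(le_trans u1); rewrite lee_fin; lra.
Qed.

Lemma energy_functionalE u G (V : 'rV[R]_N -> R) :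
  measurable_fun setT u -> measurable_fun setT V ->
  (forall i, measurable_fun setT (fun x => G x ord0 i)) ->
  {ae mu, forall x, V x = 1} ->
  (\int[mu]_x (enorm (G x) ^+ 2 + V x * `|u x| ^+ 2)%:E =
   \sum_(i < N) sqint mu (fun x => G x ord0 i) + \int[mu]_x (`|u x| ^+ 2)%:E)%E.
Proof.
move=> mu' mV mG V1.
have mu2 : measurable_fun setT (fun x => (`|u x| ^+ 2)%:E).
  by apply/measurable_EFin_sqr; exact: measurableT_comp.
have GE x : (enorm (G x) ^+ 2)%:E = (\sum_(i < N) (G x ord0 i ^+ 2)%:E)%E.
  by rewrite sumEFin sqr_sqrtr// sumr_ge0// => i _; exact: sqr_ge0.
have mG2 : measurable_fun setT (fun x => (enorm (G x) ^+ 2)%:E).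
  under eq_fun do rewrite GE.
  by apply: emeasurable_sum => i; exact: measurable_EFin_sqr.
transitivity (\int[mu]_x ((enorm (G x) ^+ 2)%:E + (`|u x| ^+ 2)%:E))%E.
  apply: ae_eq_integral => //.
  - apply/measurable_EFinP; apply: measurable_funD;
      first exact/measurable_EFinP.
    by apply: measurable_funM => //; exact/measurable_EFinP.
  - exact: emeasurable_funD.
  - by apply: filterS V1 => x /= -> _; rewrite mul1r EFinD.
rewrite ge0_integralD//; try by move=> x _; rewrite lee_fin sqr_ge0.
congr (_ + _)%E; under eq_integral do rewrite GE.
rewrite ge0_integral_sum// => [i|i x _]; first exact: measurable_EFin_sqr.
by rewrite lee_fin sqr_ge0.
Qed.

End minimization.

(** * Dilated and normalised competitors *)

Section rescaling.
Context {R : realType} {N : nat}.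
Local Notation mu := (lebesgue_row R N).
Variable alpha : R.
Hypothesis alpha_range : 0 < alpha < N%:R.
Implicit Types (u v w : 'rV[R]_N -> R).

Local Notation k := (riesz_potential (N := N) alpha).
Local Notation p := (alpha / N%:R + 1).

Lemma sqint_comp_scale (l : R) w : 0 < l -> measurable_fun setT w ->
  (sqint mu (fun x => w (l *: x)) = (l ^- N)%:E * sqint mu w)%E.
Proof.
move=> l0 mw; rewrite [in RHS]/sqint (ge0_integral_affine 0 l0); first last.
- by move=> x; rewrite lee_fin sqr_ge0.
- exact: measurable_EFin_sqr.
rewrite muleA -EFinM mulVf ?mul1e; last by rewrite expf_eq0 (gt_eqF l0) andbF.
by apply: eq_integral => x _; rewrite addr0.
Qed.

Lemma sqint_rescale (c l : R) w : 0 < l -> measurable_fun setT w ->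
  (sqint mu (fun x => c * w (l *: x))%R = (c ^+ 2 * l ^- N)%:E * sqint mu w)%E.
Proof.
move=> l0 mw; rewrite (sqint_scale _ c (measurable_comp_scale l mw)).
by rewrite (sqint_comp_scale l0 mw) muleA -EFinM.
Qed.

Lemma sqint_normr u : (\int[mu]_x (`|u x| ^+ 2)%:E = sqint mu u)%E.
Proof. by apply: eq_integral => x _; rewrite real_normK ?num_real. Qed.

Lemma riesz_energy_scale v (c l : R) : 0 <= c -> 0 < l -> measurable_fun setT v
  ->
  (riesz_energy alpha (fun x => c * v (l *: x))%R =
    (c `^ (2 * p) * (l `^ (alpha + N%:R))^-1)%:E * riesz_energy alpha v)%E.
Proof.
move=> c0 l0 mv; pose w x := `|v x| `^ p; rewrite -[RHS]/(_ * energy k w)%E.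
have -> : c `^ (2 * p) = (c `^ p) ^+ 2.
  by rewrite -powR_mulrn ?powR_ge0// -powRrM mulrC.
rewrite -energy_scale ?powR_ge0//; last 2 first.
- exact: measurable_powR_norm.
- by move=> x; exact: powR_ge0.
rewrite -[LHS]/(energy k (fun x => `|c * v (l *: x)| `^ p)); congr energy.
by apply/funext => x; rewrite normrM (ger0_norm c0) powRM.
Qed.

Lemma class_C1c_rescale v (c l : R) : 0 < l -> class_C1c v ->
  class_C1c (fun x => c * v (l *: x)).
Proof.
move=> l0 [Cv [r vr]]; apply: class_C1c_scale; split.
  have := class_C1_comp_affine l 0 Cv.
  by rewrite (_ : (fun x => _) = fun x => v (l *: x))//; apply/funext => x;
    rewrite addr0.
exists (r / l) => x; rewrite ler_pdivrMr// => rx; apply: vr.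
by rewrite normrZ gtr0_norm// mulrC.
Qed.

Lemma derive_rescale v (c l : R) i x : class_C 1 v ->
  'D_(delta_mx ord0 i) (fun x => c * v (l *: x)) x =
  c * l * 'D_(delta_mx ord0 i) v (l *: x).
Proof.
move=> [_ dv]; have [dvi _] := dv i.
have [dl Dl] := is_derive_comp_affine (dvi (l *: x + 0)).
have -> : (fun x => c * v (l *: x)) = c \*o (fun x => v (l *: x + 0)).
  by apply/funext => y /=; rewrite addr0.
by apply: (etrans (deriveMl c dl)); rewrite -mulrA; congr (c * _);
  rewrite Dl addr0.
Qed.

(** The competitor is [c * v (l *: x)] with [c] normalising its energy to 1. The parameter [l] stays
    free, so that the gradient term can be made small afterwards. *)
Lemma c_star_le (V : 'rV[R]_N -> R) v (D l : R) :
  measurable_fun setT V -> {ae mu, forall x, V x = 1} ->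
  class_C1c v -> riesz_energy alpha v = D%:E -> 0 < D -> 0 < l ->
  (c_star alpha V <= (D `^ (- p^-1))%:E *
    ((l ^+ 2)%:E * \sum_(i < N) sqint mu ('D_(delta_mx ord0 i) v) + sqint mu
      v))%E.
Proof.
move=> mV V1 Cv vD D0 l0.
have p0 := exponent_gt0 alpha_range; have N0 := dimension_gt0 alpha_range.
(* The first factor preserves the L^2 norm, and also the energy because (N/2) 2p = alpha + N. The
   second divides the energy by [D], hence the squared norm by D^(1/p). *)
pose c := l `^ (N%:R / 2) * D `^ (- (2 * p)^-1).
have c0 : 0 <= c by rewrite mulr_ge0 ?powR_ge0.
pose vl (x : 'rV[R]_N) := c * v (l *: x).
pose G (x : 'rV[R]_N) : 'rV[R]_N := \row_i 'D_(delta_mx ord0 i) vl x.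
have Cvl : class_C1c vl by exact: class_C1c_rescale.
have vlG : H1_gradient vl G := class_C1c_H1_gradient Cvl.
have mv := class_C1c_measurable Cv; have mvl := class_C1c_measurable Cvl.
have c2 : c ^+ 2 = D `^ (- p^-1) * l ^+ N.
  rewrite exprMn mulrC -!powR_mulrn ?powR_ge0 ?(ltW l0)// -!powRrM.
  rewrite mulNr invfM mulrAC mulVf// mul1r mulfVK//.
have lN : l ^+ N != 0 by rewrite expf_eq0 (gt_eqF l0) andbF.
have mD i : measurable_fun setT ('D_(delta_mx ord0 i) v).
  by have [[_ /(_ i)[_ [cD _]]] _] := Cv; exact: continuous_row_measurable.
apply: ereal_inf_lbound; exists vl, G; split=> //.
- split; last by exists G.
  by have [[cvl _] svl] := Cvl; exact: continuous_supported_Lfun2.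
- rewrite riesz_energy_scale// vD -EFinM; congr EFin.
  rewrite /c powRM ?powR_ge0// -!powRrM.
  have -> : N%:R / 2 * (2 * p) = alpha + N%:R by field; rewrite gt_eqF.
  have -> : - (2 * p)^-1 * (2 * p) = -1 by rewrite mulNr mulVf// gt_eqF//
    mulr_gt0.
  rewrite powR_inv1 ?ltW//; field.
  by rewrite !gt_eqF ?powR_gt0.
- rewrite energy_functionalE//; last first.
    by move=> i; have := vlG.2 i; move/Lfun2P => [].
  rewrite sqint_normr (sqint_rescale c l0 mv) c2 mulfK//.
  rewrite muleDr//; last first.
    rewrite ge0_adde_def// inE ?sqint_ge0// mule_ge0// ?lee_fin ?sqr_ge0//.
    by apply: sume_ge0 => i _; exact: sqint_ge0.
  congr (_ + _)%E.
  rewrite muleA -EFinM ge0_sume_distrr; last by move=> i _; exact: sqint_ge0.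
  apply: eq_bigr => i _.
  have -> : D `^ (- p^-1) * l ^+ 2 = (c * l) ^+ 2 * l ^- N.
    by rewrite exprMn c2 mulrAC mulfK.
  rewrite -(sqint_rescale (c * l) l0 (mD i)); congr (sqint mu _).
  by apply/funext => x; rewrite /G mxE -(derive_rescale c l i x Cv.1).
Qed.

End rescaling.

(** * The two inequalities *)

Section lower_upper.
Context {R : realType} {N : nat}.
Local Notation mu := (lebesgue_row R N).
Variable alpha : R.
Hypothesis alpha_range : 0 < alpha < N%:R.
Variable V : 'rV[R]_N -> R.
Hypothesis mV : measurable_fun setT V.
Hypothesis V1 : {ae mu, forall x, V x = 1}.
Implicit Types (u v : 'rV[R]_N -> R).

Lemma c_infty_le_c_star : (c_infty N alpha <= c_star alpha V)%E.
Proof.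
apply/ereal_infP => _ [u [G [[u2 _] [_ G2] uD ->]]].
have [mu' _] := (Lfun2P mu u).1 u2.
have mG i : measurable_fun setT (fun x => G x ord0 i).
  by have /Lfun2P[] := G2 i.
apply: (@le_trans _ _ (\int[mu]_x (`|u x| ^+ 2)%:E)%E).
  by apply: ereal_inf_lbound; exists u.
rewrite energy_functionalE//.
by rewrite leeDr// sume_ge0// => i _; exact: sqint_ge0.
Qed.

Lemma c_star_le_c_infty : (c_star alpha V <= c_infty N alpha)%E.
Proof.
apply/ereal_infP => _ [u [u2 uD] <-]; rewrite sqint_normr.
have [mu' uoo] := (Lfun2P mu u).1 u2.
have p0 := exponent_gt0 alpha_range; have p1 := exponent_ge1 alpha_range.
pose s := fine (sqint mu u).
have sE : sqint mu u = s%:E by rewrite fineK// ge0_fin_numE// sqint_ge0.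
have s0 : 0 <= s by rewrite fine_ge0// sqint_ge0.
rewrite sE; apply/lee_addgt0Pr => d d0.
(* The solution of (s + 2e) / (1 - e) = s + d, so the last estimate gives exactly the allowed excess
   [d]. *)
pose e := d / (2 + s + d).
have t0 : 0 < 2 + s + d by lra.
have e0 : 0 < e by exact: divr_gt0.
have e1 : e < 1 by rewrite ltr_pdivrMr//; lra.
have [|v [Cv vs vD]] := riesz_energy_approx alpha_range u2 e0;
  first by rewrite uD.
have vDoo : (riesz_energy alpha v < +oo)%E.
  have [[cv _] sv] := Cv; have [C C0 vC] := continuous_supported_bounded cv sv.
  apply: (@energy_lty _ _ _ alpha_range (fun x =>
    `|v x| `^ _) (C `^ (alpha / N%:R + 1))).
  - by apply: measurable_powR_norm; exact: class_C1c_measurable.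
  - by move=> x; rewrite powR_ge0/= ge0_ler_powR ?nnegrE ?(ltW p0).
  - by have [r vr] := sv; exists r => x /vr ->; rewrite normr0 powR0// gt_eqF.
pose D := fine (riesz_energy alpha v).
have DE : riesz_energy alpha v = D%:E.
  by rewrite fineK// ge0_fin_numE// (le_trans _ (ltW vD))// lee_fin; lra.
have De : 1 - e < D by move: vD; rewrite DE lte_fin.
have D0 : 0 < D by lra.
pose g := fine (\sum_(i < N) sqint mu ('D_(delta_mx ord0 i) v)).
have gE : (\sum_(i < N) sqint mu ('D_(delta_mx ord0 i) v) = g%:E)%E.
  rewrite fineK// ge0_fin_numE; last by apply: sume_ge0 => i _;
    exact: sqint_ge0.
  apply: lte_sum_pinfty => i _; have [[_ /(_ i)[_ [cD _]]] sv] := Cv.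
  by have /Lfun2P[] := continuous_supported_Lfun2 cD (derive_supported i sv).
have g0 : 0 <= g.
  by rewrite fine_ge0// sume_ge0// => i _; exact: sqint_ge0.
have [l l0 lg] : exists2 l : R, 0 < l & l ^+ 2 * g <= e.
  (* The added 1 keeps the quotient defining [l] well behaved when the gradient vanishes. *)
  have g1 : 0 < g + 1 by rewrite ltr_wpDl.
  exists (Num.sqrt (e / (g + 1))); first by rewrite sqrtr_gt0 divr_gt0.
  have -> : Num.sqrt (e / (g + 1)) ^+ 2 = e / (g + 1).
    by rewrite sqr_sqrtr// divr_ge0// ltW.
  by rewrite mulrAC ler_pdivrMr// ler_pM2l// lerDl.
apply: le_trans (c_star_le alpha_range mV V1 Cv DE D0 l0) _.
(* Since p >= 1 and 0 < 1 - e <= 1, the exponent 1/p may be replaced by 1, which frees the final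
   estimate from p. *)
have DD : D `^ (- (alpha / N%:R + 1)^-1) <= (1 - e)^-1.
  have e10 : 0 < 1 - e by lra.
  apply: (@le_trans _ _ ((1 - e) `^ (- (alpha / N%:R + 1)^-1))).
    by rewrite !powRN lef_pV2 ?posrE ?powR_gt0// ge0_ler_powR
      ?nnegrE ?invr_ge0 ?ltW.
  have e01 : 0 < 1 - e <= 1 by rewrite e10 lerBlDr lerDl ltW.
  by rewrite -[leRHS]powR_inv1 ?(ltW e10)// (ger_powR e01)// lerN2 invf_le1.
apply: (@le_trans _ _ ((1 - e)^-1%:E * (e%:E + (s%:E + e%:E)))%E).
  apply: lee_pmul; rewrite ?lee_fin ?powR_ge0//.
    rewrite adde_ge0 ?sqint_ge0// mule_ge0 ?lee_fin ?sqr_ge0//.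
    by rewrite gE lee_fin.
  by rewrite -sE; apply: leeD => //; rewrite gE -EFinM lee_fin.
rewrite -!EFinD -EFinM lee_fin mulrC ler_pdivrMr; last by lra.
have : e * (2 + s + d) = d by rewrite divfK// gt_eqF.
by lra.
Qed.

End lower_upper.

Theorem lemma4 (R : realType) (N : nat) (alpha : R) (V : 'rV[R]_N -> R)
    (N_ge1 : (1 <= N)%N) (alpha_range : 0 < alpha < N%:R)
    (V_Linfty : V \in Lfun (lebesgue_row R N) +oo%E)
    (V_eq1 : {ae lebesgue_row R N, forall x, V x = 1}) :
  c_star alpha V = c_infty N alpha.
Proof.
have mV : measurable_fun setT V by move: V_Linfty;
  rewrite inE => /andP[/[!inE]].
apply/eqP; rewrite eq_le c_infty_le_c_star// andbT.
exact: c_star_le_c_infty.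
Qed.
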